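(* Let $n\ge1$. For all $u\in W^{1,2}(\mathbb{R}^n,\gamma)$ the following hold. (a) (Sharp stability estimates) $$\delta_\gamma(u)\ge\inf_{c\in\mathbb{R},\ \mathbf{a}\in\mathbb{R}^n}\int_{\mathbb{R}^n}|u-c-\mathbf{a}\cdot x|^2\,d\gamma,\qquad \delta_\gamma(u)\ge\frac12\inf_{\mathbf{d}\in\mathbb{R}^n}\int_{\mathbb{R}^n}|\nabla u-\mathbf{d}|^2\,d\gamma,$$ and in each of these two inequalities equality holds if and only if $u\in\mathcal{P}_2$. (b) (Sharp stability of the stability estimates) $$\delta_\gamma(u)-\inf_{c\in\mathbb{R},\ \mathbf{a}\in\mathbb{R}^n}\int_{\mathbb{R}^n}|u-c-\mathbf{a}\cdot x|^2\,d\gamma\ge\inf_{P\in\mathcal{P}_2}\int_{\mathbb{R}^n}|u-P|^2\,d\gamma,$$ $$\delta_\gamma(u)-\frac12\inf_{\mathbf{d}\in\mathbb{R}^n}\int_{\mathbb{R}^n}|\nabla u-\mathbf{d}|^2\,d\gamma\ge\frac16\inf_{P\in\mathcal{P}_2}\int_{\mathbb{R}^n}|\nabla(u-P)|^2\,d\gamma,$$ and in each of these two inequalities equality holds if and only if $u\in\mathcal{P}_3$. (c) (Exact identities) $$\int_{\mathbb{R}^n}|\nabla u|^2\,d\gamma-\inf_{c\in\mathbb{R}}\int_{\mathbb{R}^n}|u-c|^2\,d\gamma=\sum_{j=1}^{\infty}\inf_{P\in\mathcal{P}_j}\int_{\mathbb{R}^n}|u-P|^2\,d\gamma=\sum_{j=1}^{\infty}\frac{1}{j(j+1)}\inf_{P\in\mathcal{P}_j}\int_{\mathbb{R}^n}|\nabla(u-P)|^2\,d\gamma.$$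 All the constants above are optimal; that is, the constants $1$ and $\frac12$ in (a), and the constants $1$ and $\frac16$ on the right-hand sides in (b), cannot be replaced by larger ones.
   Context: $d\gamma=(2\pi)^{-n/2}e^{-|x|^2/2}\,dx$ is the standard Gaussian measure on $\mathbb{R}^n$, and $W^{1,2}(\mathbb{R}^n,\gamma)$ is the corresponding (real-valued) Sobolev space of functions $u\in L^2(\gamma)$ with weak gradient in $L^2(\gamma)$. $\mathcal{P}_m$ is the space of real polynomials of degree at most $m$ on $\mathbb{R}^n$. The Gaussian Poincaré deficit is $$\delta_\gamma(u)=\int_{\mathbb{R}^n}|\nabla u|^2\,d\gamma-\inf_{c\in\mathbb{R}}\int_{\mathbb{R}^n}|u-c|^2\,d\gamma .$$ *)

(* Defs.v *)
From HB Require Import structures.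
From mathcomp Require Import all_boot all_order all_algebra.
(* The notations of mpoly clash with those of the analysis library. *)
From mathcomp Require Import -(notations) mpoly.
From mathcomp Require Import all_classical all_reals all_analysis.
From mathcomp Require Import measurable_realfun.

Set Implicit Arguments.
Unset Strict Implicit.
Unset Printing Implicit Defensive.

Import Order.TTheory GRing.Theory Num.Theory.
Import numFieldNormedType.Exports.

Local Open Scope classical_set_scope.
Local Open Scope ring_scope.

(* R^n is 'rV[R]_n, with the product sigma-algebra generated by the coordinates
   (which is the Borel sigma-algebra of its topology). *)
Definition rV_display : measure_display -> measure_display.
Proof. exact. Qed.

Section measurable_rV.
Context {d} {T : measurableType d}.
Variable n : nat.

Let coors : 'I_n -> 'rV[T]_n -> T := fun i x => x 0 i.

Let rV_set0 : g_sigma_preimage coors set0.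
Proof. exact: sigma_algebra0. Qed.

Let rV_setC A : g_sigma_preimage coors A -> g_sigma_preimage coors (~` A).
Proof. exact: sigma_algebraC. Qed.

Let rV_bigcup (F : _^nat) : (forall i, g_sigma_preimage coors (F i)) ->
  g_sigma_preimage coors (\bigcup_i (F i)).
Proof. exact: sigma_algebra_bigcup. Qed.

HB.instance Definition _ := @isMeasurable.Build (rV_display d)
  ('rV[T]_n) (g_sigma_preimage coors) rV_set0 rV_setC rV_bigcup.

End measurable_rV.


Section measurable_fun_rV.
Context {d d'} {T : measurableType d} {T' : measurableType d'}.

Lemma measurable_coord n (i : 'I_n) :
  measurable_fun [set: 'rV[T]_n] (fun x => x 0 i).
Proof.
move=> _ Y mY; rewrite setTI; apply: sub_sigma_algebra => /=.
rewrite -bigcup_seq/=; exists i => /=; first by rewrite mem_index_enum.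
by exists Y => //; rewrite setTI.
Qed.

Lemma measurable_fun_rV n (f : T' -> 'rV[T]_n) :
  (forall i, measurable_fun setT (fun x => f x 0 i)) -> measurable_fun setT f.
Proof.
move=> mf _ Y mY; rewrite setTI.
suff: g_sigma_preimage (fun i x => f x 0 i) `<=` @measurable _ T'.
  apply; rewrite (g_sigma_preimage_comp (fun (i : 'I_n) (x : 'rV[T]_n) => x 0 i) f).
  by exists Y => //; rewrite setTI.
apply: smallest_sub; first exact: sigma_algebra_measurable.
case: n => [|n] in f mf Y mY *; first by rewrite big_ord0.
rewrite -bigcup_mkord_ord; apply: bigcup_sub => i Ii.
by move=> A [B mB <-]; exact: mf.
Qed.

End measurable_fun_rV.

Section lebesgue_rV.
Context {R : realType}.

Definition rV_cons n (p : R * 'rV[R]_n) : 'rV[R]_n.+1 :=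
  row_mx (const_mx p.1 : 'rV[R]_1) p.2.

Definition rV_split n (x : 'rV[R]_n.+1) : R * 'rV[R]_n :=
  (x 0 0, rsubmx (x : 'rV[R]_(1 + n))).

Lemma rV_consK n : cancel (@rV_cons n) (@rV_split n).
Proof.
move=> [a x]; rewrite /rV_cons /rV_split; congr pair; last by rewrite row_mxKr.
transitivity (row_mx (const_mx a : 'rV_1) x 0 (lshift n 0)).
  by congr (row_mx _ _ 0 _); exact: val_inj.
by rewrite row_mxEl mxE.
Qed.

Lemma measurable_rV_cons n :
  measurable_fun [set: measurableTypeR R * 'rV[R]_n] (@rV_cons n).
Proof.
apply: measurable_fun_rV => i.
rewrite [X in measurable_fun _ X](_ : _ = fun p : R * 'rV[R]_n =>
  match fintype.split (i : 'I_(1 + n)) with inl _ => p.1 | inr j => p.2 0 j end);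
  last by apply/funext => p; rewrite /rV_cons mxE; case: fintype.split => j //;
    rewrite mxE.
case: fintype.split => j; first exact: measurable_fst.
exact: (measurableT_comp (measurable_coord j) measurable_snd).
Qed.

Lemma measurable_rV_split n :
  measurable_fun [set: 'rV[R]_n.+1]
    (@rV_split n : 'rV[R]_n.+1 -> measurableTypeR R * 'rV[R]_n).
Proof.
apply/measurable_fun_pair.
  exact: measurable_coord.
apply: measurable_fun_rV => i.
rewrite [X in measurable_fun _ X](_ : _ = fun x : 'rV[R]_n.+1 => x 0 (rshift 1 i)).
  exact: measurable_coord.
by apply/funext => x; rewrite mxE.
Qed.

Section step.
Variables (n : nat) (m : {sigma_finite_measure set 'rV[R]_n -> \bar R}).

Definition lebesgue_step : set 'rV[R]_n.+1 -> \bar R :=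
  pushforward (@lebesgue_measure R \x m)%E (@rV_cons n).

HB.instance Definition _ := Measure.copy lebesgue_step
  (* pushforward under a map whose measurability proof cannot be inferred *)
  (@measure_function_pushforward__canonical__measure_function_Measure _ _ _ _ R
   (@lebesgue_measure R \x m)%E _ (@measurable_rV_cons n)).

Let lebesgue_step_sigma_finite : sigma_finite setT lebesgue_step.
Proof.
have /sigma_finiteP[F [TF ndF Foo]] := sigma_finiteT (@lebesgue_measure R).
have /sigma_finiteP[G [TG ndG Goo]] := sigma_finiteT m.
exists (fun i => @rV_split n @^-1` (F i `*` G i)).
  rewrite -preimage_bigcup -(preimage_setT (@rV_split n)); congr (_ @^-1` _).
  rewrite -setXTT TF TG predeqE => -[x y]; split.
    move=> [/= [i _ Fx] [k _ Gy]]; exists (maxn i k) => //; split.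
    - by move: x Fx; exact/subsetPset/ndF/leq_maxl.
    - by move: y Gy; exact/subsetPset/ndG/leq_maxr.
  by move=> [i _ []/= ? ?]; split; exists i.
move=> i; have [mF Fi] := Foo i; have [mG Gi] := Goo i.
have mFG := measurableX mF mG; split.
  by rewrite -[X in measurable X]setTI; exact: measurable_rV_split.
rewrite /lebesgue_step /pushforward -comp_preimage (_ : _ \o _ = id); last first.
  by apply/funext => x; exact: rV_consK.
by rewrite preimage_id product_measure1E// lte_mul_pinfty// ge0_fin_numE.
Qed.

HB.instance Definition _ := Measure_isSigmaFinite.Build _ _ _ lebesgue_step
  lebesgue_step_sigma_finite.

End step.


(* Lebesgue measure on R^n: the unit mass for n = 0, and for n + 1 the image of
   the product of the Lebesgue measures on R and R^n. *)
Fixpoint lebesgue_rV n : {sigma_finite_measure set 'rV[R]_n -> \bar R} :=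
  if n is k.+1 then lebesgue_step (lebesgue_rV k) else dirac (0 : 'rV[R]_0).

End lebesgue_rV.
Arguments lebesgue_rV R n : clear implicits.

Section gaussian.
Context (R : realType) (n : nat).
Implicit Types (x : 'rV[R]_n) (A : set 'rV[R]_n).

Definition dotrV (x y : 'rV[R]_n) : R := \sum_(i < n) x 0 i * y 0 i.
Definition sqnorm x : R := dotrV x x.

Definition gaussian_pdf x : R :=
  (2 * pi) `^ (- (n%:R / 2)) * expR (- (sqnorm x / 2)).

Let gaussian_pdf_ge0 x : 0 <= gaussian_pdf x.
Proof. by rewrite mulr_ge0 ?powR_ge0 ?expR_ge0. Qed.

Let measurable_gaussian_pdf : measurable_fun setT gaussian_pdf.
Proof.
apply: measurable_funM => //; apply: measurableT_comp => //.
apply: measurableT_comp => //; apply: measurable_funM => //.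
by apply: measurable_sum => i; apply: measurable_funM; exact: measurable_coord.
Qed.

Definition gaussian A : \bar R :=
  (\int[lebesgue_rV R n]_(x in A) (gaussian_pdf x)%:E)%E.

Let gaussian0 : gaussian set0 = 0%E.
Proof. by rewrite /gaussian integral_set0. Qed.

Let gaussian_ge0 A : (0 <= gaussian A)%E.
Proof. by apply: integral_ge0 => x _; rewrite lee_fin. Qed.

Let gaussian_sigma_additive : semi_sigma_additive gaussian.
Proof.
move=> /= A mA tA mUA; rewrite /gaussian ge0_integral_bigcup//; last 2 first.
- by apply/measurable_EFinP; exact: measurable_funTS.
- by move=> x _; rewrite lee_fin.
by apply: is_cvg_ereal_nneg_natsum_cond => k _ _; exact: gaussian_ge0.
Qed.

HB.instance Definition _ := isMeasure.Build _ _ _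
  gaussian gaussian0 gaussian_ge0 gaussian_sigma_additive.

End gaussian.
Arguments gaussian R n : clear implicits.

Section sobolev.
Context (R : realType) (n : nat).
Implicit Types (u v phi : 'rV[R]_n -> R) (g : 'rV[R]_n -> 'rV[R]_n).

Definition partial (i : 'I_n) phi : 'rV[R]_n -> R :=
  fun x => 'D_(delta_mx 0 i) phi x.

(* C^oo: the iterated partial derivatives of all orders exist and are
   continuous; [foldr partial phi s] differentiates along the indices in s. *)
Definition smooth phi := forall s : seq 'I_n,
  continuous (foldr partial phi s) /\
  forall i x, derivable (foldr partial phi s) x (delta_mx 0 i).

Definition test_function phi :=
  smooth phi /\ compact (closure [set x | phi x != 0]).

Definition L2gauss : {pred 'rV[R]_n -> R} := Lfun (gaussian R n) 2%:E.

(* The integrals converge absolutely for u and the components of g in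
   L^2(gamma), which is contained in L^1_loc. *)
Definition weak_gradient u g := forall phi, test_function phi ->
  forall i : 'I_n,
  (\int[lebesgue_rV R n]_x (u x * partial i phi x)%:E =
   - \int[lebesgue_rV R n]_x (g x 0 i * phi x)%:E)%E.

Definition L2_weak_gradient u : set ('rV[R]_n -> 'rV[R]_n) :=
  [set g | weak_gradient u g /\ forall i, (fun x => g x 0 i) \in L2gauss].

Definition W12 : set ('rV[R]_n -> R) :=
  [set u | u \in L2gauss /\ L2_weak_gradient u !=set0].

(* The weak gradient is unique up to a null set; [grad u] is a representative
   when u is in W12 (and a dummy value otherwise). *)
Definition grad u : 'rV[R]_n -> 'rV[R]_n := xget (cst 0) (L2_weak_gradient u).

(* [mmeasure mdeg p], i.e. [msize p], is the degree of p plus 1 when p != 0,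
   and 0 when p = 0. *)
Definition polyfun (m : nat) : set ('rV[R]_n -> R) :=
  [set P | exists2 p : mpoly n R, (mmeasure mdeg p <= m.+1)%N &
           P = fun x : 'rV[R]_n => meval (fun i => x 0 i) p].

(* u is in P_m, as an element of L^2(gamma). *)
Definition ae_polyfun (m : nat) u :=
  exists2 P, polyfun m P & {ae gaussian R n, forall x, u x = P x}.

Local Open Scope ereal_scope.

Definition sqL2 u : \bar R := \int[gaussian R n]_x ((u x) ^+ 2)%:E.
Definition sqL2v g : \bar R := \int[gaussian R n]_x (sqnorm (g x))%:E.

(* The dist_ below are squared distances. *)
Definition dist_const u : \bar R :=
  ereal_inf [set sqL2 (fun x => u x - c)%R | c in [set: R]].

Definition deficit u : \bar R := sqL2v (grad u) - dist_const u.

Definition dist_affine u : \bar R :=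
  ereal_inf [set sqL2 (fun x => u x - ca.1 - dotrV ca.2 x)%R
            | ca in [set: R * 'rV[R]_n]].

Definition dist_grad_const u : \bar R :=
  ereal_inf [set sqL2v (fun x => grad u x - d)%R | d in [set: 'rV[R]_n]].

Definition dist_poly (m : nat) u : \bar R :=
  ereal_inf [set sqL2 (fun x => u x - P x)%R | P in polyfun m].

Definition dist_grad_poly (m : nat) u : \bar R :=
  ereal_inf [set sqL2v (grad (fun x => u x - P x)%R) | P in polyfun m].

End sobolev.
Arguments W12 R n : clear implicits.

(* Main.v *)
Require Import Defs.
From mathcomp Require Import all_boot all_order all_algebra.
From mathcomp Require Import -(notations) mpoly.
From mathcomp Require Import all_classical all_reals all_analysis.
From mathcomp Require Import ring lra measurable_realfun.

Set Implicit Arguments.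
Unset Strict Implicit.
Unset Printing Implicit Defensive.

Import Order.TTheory GRing.Theory Num.Theory.
Import numFieldNormedType.Exports.

Local Open Scope classical_set_scope.
Local Open Scope ring_scope.

(** The mechanism is spectral. Write u_k for the component of u in the k-th
    Hermite space, the orthogonal complement in L^2(gamma) of the polynomials of
    degree below k inside those of degree at most k. Differentiation lowers the
    degree by one and its Gaussian adjoint is x_i - d/dx_i, so that the number
    operator sum_i (x_i - d/dx_i) d/dx_i acts on the k-th Hermite space as k times
    the identity, and |grad u|^2 integrates to the sum of the k |u_k|^2. With

      D_m = sum_(k > m) |u_k|^2,     E_m = sum_(k > m) k |u_k|^2,

    D_m is the squared distance of u to the polynomials of degree at most m and
    E_m is that of its gradient to theirs, the gradient of the projection of u
    being optimal. The deficit is E_0 - D_0, the distance to the affine functions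
    is D_1, and that of the gradient to the constant fields is E_1.

    Hermite expansions can be bypassed: five facts about the two sequences are
    enough. D is nonnegative and nonincreasing, D and E tend to 0, and

      E_m - E_(m+1) = (m + 1) (D_m - D_(m+1)).

    This recurrence ([gdist2_succ]) rests on [is_proj_gradc], which says that
    differentiation intertwines the projections on degrees m + 1 and m, and on
    [number_operator]: up to lower degree the number operator is Euler's operator
    sum_i x_i d/dx_i, which multiplies a polynomial of degree m + 1 by m + 1 up to
    lower degree. From there on everything is arithmetic of the quantities
    gap_m = E_m - (m + 1) D_m: they are nonnegative, they satisfy
    gap_m = gap_(m+1) + D_(m+1), and gap_m vanishes exactly when D_(m+1) does,
    that is when u is a polynomial of degree at most m + 1. The two series
    telescope, and the monomials x_i^2 and x_i^3 attain equality, whence the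
    optimality of the constants.

    Two facts feed this scheme. The convergence of D and E to 0 is the density of
    the polynomials in L^2(gamma) ([approx_L2]). It comes from the functions by
    which multiplication preserves the closure of the polynomials: they form an
    algebra closed under bounded pointwise limits, hence under the exponential, and
    contain the bounded functions (x_i - a) exp(- x_i^2 / 8); therefore they contain
    the indicators of half-spaces, then those of all Borel sets. The identity of the moments of the weak gradient, int g_i p = int u (x_i p -
    dp/dx_i) for polynomials p ([weak_ibp]), comes from test functions
    p exp(- |x|^2 / 2) cut off by a smooth function of |x|^2 / k with k tending to
    infinity; conversely the classical gradient of a polynomial is its weak gradient
    by Fubini's theorem and the fundamental theorem of calculus
    ([weak_gradient_Pol]). *)

(** * Integration against the Gaussian and the Lebesgue measures *)

Section dominated.
Context d (T : measurableType d) (R : realType) (mu : {measure set T -> \bar R}).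

Lemma Rintegral_dominated_cvg (f_ : nat -> T -> R) (f g : T -> R) :
  (forall k, measurable_fun setT (f_ k)) -> measurable_fun setT f ->
  (forall x, (fun k => f_ k x) @ \oo --> f x) ->
  mu.-integrable setT (EFin \o g) -> (forall k x, `|f_ k x| <= g x) ->
  \int[mu]_x f_ k x @[k --> \oo] --> \int[mu]_x f x.
Proof.
move=> mf_ mf cf ig fg.
have [|||||i1 _ i3] := @dominated_convergence _ _ _ mu setT measurableT
  (fun k => EFin \o f_ k) (EFin \o f) (EFin \o g).
- by move=> k; apply/measurable_EFinP.
- exact/measurable_EFinP.
- apply: aeW => x _; apply: cvg_EFin; last exact: cf.
  exact: nearW.
- exact: ig.
- by apply: aeW => x k _; rewrite lee_fin; exact: fg.
apply: fine_cvg; rewrite fineK//.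
exact: integrable_fin_num.
Qed.

End dominated.

Section density.
Context (R : realType) (n : nat).
Local Notation gamma := (gaussian R n).
Local Notation lam := (lebesgue_rV R n).
Local Notation G := (@gaussian_pdf R n).

Lemma gaussian_pdf_gt0 (x : 'rV[R]_n) : 0 < G x.
Proof. by rewrite mulr_gt0 ?expR_gt0// powR_gt0// mulr_gt0 ?pi_gt0. Qed.

Lemma measurable_sqnorm : measurable_fun setT (@sqnorm R n).
Proof.
by apply: measurable_sum => i; apply: measurable_funM; exact: measurable_coord.
Qed.

Lemma measurable_gaussian_pdf : measurable_fun setT G.
Proof.
apply: measurable_funM => //; apply: measurableT_comp => //.
apply: measurableT_comp => //; apply: measurable_funM => //.
exact: measurable_sqnorm.
Qed.

Import HBNNSimple.
Local Open Scope ereal_scope.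

(** By definition the Gaussian measure of a set is the integral of the density over
    it; the formula extends from indicators to simple functions by linearity and to
    nonnegative functions by monotone convergence. *)
Lemma ge0_integral_gaussian (f : 'rV[R]_n -> \bar R) :
  (forall x, 0 <= f x) -> measurable_fun setT f ->
  \int[gamma]_x f x = \int[lam]_x (f x * (G x)%:E).
Proof.
move=> f0 mf; set g := fun x => (G x)%:E.
have g0 x : 0 <= g x by rewrite lee_fin ltW// gaussian_pdf_gt0.
have mg : measurable_fun setT g by apply/measurable_EFinP; exact: measurable_gaussian_pdf.
pose h := nnsfun_approx measurableT mf.
have -> : \int[gamma]_x f x =
    lim (\int[gamma]_x (EFin \o h n) x @[n --> \oo]).
  have fE x : f x = lim ((EFin \o h n) x @[n --> \oo]).
    by apply/esym/cvg_lim => //; exact: cvg_nnsfun_approx.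
  under eq_integral => x _ do rewrite fE.
  apply: monotone_convergence => //.
  - by move=> k; apply/measurable_EFinP; exact/measurable_funP.
  - by move=> k x _ //=; rewrite lee_fin.
  - by move=> x _ a b ab; rewrite lee_fin; exact/lefP/nd_nnsfun_approx.
have -> : \int[lam]_x (f x * g x) =
    lim (\int[lam]_x ((EFin \o h n) \* g) x @[n --> \oo]).
  have fg x : f x * g x = lim (((EFin \o h n) \* g) x @[n --> \oo]).
    by apply/esym/cvg_lim => //; apply: cvgeZr => //; exact: cvg_nnsfun_approx.
  under eq_integral => x _ do rewrite fg.
  apply: monotone_convergence => //.
  - move=> k; apply/emeasurable_funM => //.
    exact/measurable_EFinP.
  - by move=> k x _ /=; apply: mule_ge0; last exact: g0; rewrite lee_fin.
  - move=> x _ a b ab/=; apply: lee_wpmul2r; first exact: g0.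
    by rewrite lee_fin; exact/lefP/nd_nnsfun_approx.
suff suf k : \int[lam]_x ((EFin \o h k) x * g x) =
    \int[gamma]_x (EFin \o h k) x.
  by under [in RHS]eq_fun do rewrite suf.
transitivity (\int[gamma]_x
   (\sum_(y \in range (h k)) (y * \1_(h k @^-1` [set y]) x)%:E)); last first.
  by apply: eq_integral => t tE; rewrite /= fimfunE -fsumEFin.
have indich r : measurable_fun setT (fun x => (r * \1_(h k @^-1` [set r]) x)%:E).
  by apply: (measurable_comp measurableT) => //; exact: measurable_funM.
rewrite ge0_integral_fsum//; last by move=> m y Ey; exact: nnfun_muleindic_ge0.
transitivity (\int[lam]_x (\sum_(y \in range (h k))
    (y * \1_(h k @^-1` [set y]) x)%:E * g x)).
  under [RHS]eq_integral => x xE.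
    rewrite -ge0_mule_fsuml => [|y]; last exact: nnfun_muleindic_ge0.
    rewrite fsumEFin // -(fimfunE _ x); over.
  by [].
rewrite ge0_integral_fsum//; last 2 first.
  - by move=> y; apply: emeasurable_funM.
  - by move=> m y Ey; apply: mule_ge0; [exact: nnfun_muleindic_ge0|exact: g0].
apply: eq_fsbigr => r rhn.
under [RHS]eq_integral do rewrite EFinM.
rewrite integralZl_indic_nnsfun => //.
under eq_integral do rewrite EFinM -muleA.
rewrite ge0_integralZl//.
- under eq_integral do rewrite muleC.
  rewrite (eq_integral (g \_ (h k @^-1` [set r]))); last first.
    by move=> x xE; rewrite epatch_indic.
  by rewrite -integral_mkcond integral_indic// setIT.
- by apply: emeasurable_funM => //; exact/measurable_EFinP.
- by move=> t _; apply: mule_ge0; [rewrite lee_fin|exact: g0].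
- by move: rhn; rewrite inE => -[t _ <-]; rewrite lee_fin.
Qed.

Lemma integral_gaussian (f : 'rV[R]_n -> R) : measurable_fun setT f ->
  \int[gamma]_x (f x)%:E = \int[lam]_x (f x * G x)%:E.
Proof.
move=> mf; rewrite integralE [RHS]integralE.
have mF : measurable_fun setT (EFin \o f) by exact/measurable_EFinP.
rewrite (ge0_integral_gaussian (funepos_ge0 _) (measurable_funepos mF)).
rewrite (ge0_integral_gaussian (funeneg_ge0 _) (measurable_funeneg mF)).
congr (_ - _); apply: eq_integral => x _.
  by rewrite !funeposE -!EFin_max -EFinM maxr_pMl ?mul0r// ltW// gaussian_pdf_gt0.
rewrite !funenegE -!EFinN -!EFin_max -EFinM maxr_pMl ?mul0r ?mulNr//.
by rewrite ltW// gaussian_pdf_gt0.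
Qed.

Lemma integrable_gaussian (f : 'rV[R]_n -> R) : measurable_fun setT f ->
  gamma.-integrable setT (EFin \o f) <->
  lam.-integrable setT (fun x => (f x * G x)%:E).
Proof.
move=> mf; have mfG : measurable_fun setT (fun x => (f x * G x)%R).
  by apply: measurable_funM => //; exact: measurable_gaussian_pdf.
have E : \int[gamma]_x `|(f x)%:E| = \int[lam]_x `|(f x * G x)%:E|.
  rewrite ge0_integral_gaussian//; last first.
    by apply: measurableT_comp => //; exact/measurable_EFinP.
  apply: eq_integral => x _ /=.
  by rewrite normrM (gtr0_norm (gaussian_pdf_gt0 x)).
split=> /integrableP[_ h]; apply/integrableP; split.
- exact/measurable_EFinP.
- by rewrite -E.
- exact/measurable_EFinP.
- by rewrite /= E.
Qed.

End density.

Section fubini.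
Context (R : realType) (n : nat).
Local Notation lam := (lebesgue_rV R n).
Local Notation mu := (@lebesgue_measure R).
Local Open Scope ereal_scope.
Implicit Type f : 'rV[R]_n.+1 -> \bar R.

Lemma ge0_integral_lebesgue_rVS f : (forall x, 0 <= f x) -> measurable_fun setT f ->
  \int[lebesgue_rV R n.+1]_x f x = \int[mu]_t \int[lam]_y f (rV_cons (t, y)).
Proof.
move=> f0 mf.
have -> : \int[lebesgue_rV R n.+1]_x f x =
    \int[pushforward (mu \x lam) (@rV_cons R n)]_x f x by [].
rewrite ge0_integral_pushforward//=; last exact: measurable_rV_cons.
rewrite preimage_setT fubini_tonelli1//.
exact: (measurableT_comp mf (@measurable_rV_cons R n)).
Qed.

Lemma integrable_rV_cons f : (lebesgue_rV R n.+1).-integrable setT f ->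
  (mu \x lam).-integrable setT (f \o @rV_cons R n).
Proof.
move=> /integrableP[mf foo]; have mfc := measurableT_comp mf (@measurable_rV_cons R n).
apply/integrableP; split => //.
rewrite fubini_tonelli1//; last exact: measurableT_comp.
move: foo; rewrite ge0_integral_lebesgue_rVS//.
exact: measurableT_comp.
Qed.

Lemma integral_lebesgue_rVS1 f : (lebesgue_rV R n.+1).-integrable setT f ->
  \int[lebesgue_rV R n.+1]_x f x = \int[mu]_t \int[lam]_y f (rV_cons (t, y)).
Proof.
move=> fi; have fci := integrable_rV_cons fi.
have -> : \int[lebesgue_rV R n.+1]_x f x =
    \int[pushforward (mu \x lam) (@rV_cons R n)]_x f x by [].
rewrite integral_pushforward//=; first by rewrite preimage_setT -integral12_prod_meas1.
- exact: measurable_rV_cons.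
- exact: measurable_int fi.
Qed.

Lemma integral_lebesgue_rVS2 f : (lebesgue_rV R n.+1).-integrable setT f ->
  \int[lebesgue_rV R n.+1]_x f x = \int[lam]_y \int[mu]_t f (rV_cons (t, y)).
Proof.
move=> fi; have fci := integrable_rV_cons fi.
by rewrite integral_lebesgue_rVS1// (Fubini fci).
Qed.

End fubini.

(** * Integrability of the Gaussian functions *)

Section gaussian_decay.
Context (R : realType).
Local Notation mu := (@lebesgue_measure R).

(** The function is a multiple of the density of the normal law of variance
    1 / (2 c). *)
Lemma integrable_expR_sqr (c : R) : 0 < c ->
  mu.-integrable setT (fun t => (expR (- (c * t ^+ 2)))%:E).
Proof.
move=> c0; pose s := Num.sqrt (2 * c)^-1.
have s2 : s ^+ 2 = (2 * c)^-1 by rewrite sqr_sqrtr// invr_ge0 mulr_ge0// ltW.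
have s0 : s != 0 by rewrite gt_eqF// sqrtr_gt0 invr_gt0 mulr_gt0.
have p0 := normal_peak_gt0 s0.
rewrite (_ : (fun t => _) = (fun t => ((normal_peak s)^-1)%:E * (normal_pdf 0 s t)%:E)%E).
  by apply: integrableZl => //; exact: integrable_normal_pdf.
apply/funext => t; rewrite -EFinM normal_pdfE //= /normal_fun /=.
rewrite mulKf ?gt_eqF// subr0 s2; congr (expR _)%:E.
by field; rewrite gt_eqF.
Qed.

Lemma rV_cons0 n (t : R) (y : 'rV[R]_n) : rV_cons (t, y) 0 0 = t.
Proof. exact: (congr1 fst (rV_consK (t, y))). Qed.

Lemma rV_consS n (t : R) (y : 'rV[R]_n) i : rV_cons (t, y) 0 (lift ord0 i) = y 0 i.
Proof.
have /(congr1 snd)/= /rowP/(_ i) := rV_consK (t, y).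
rewrite mxE => yE; rewrite -[RHS]yE; congr (rV_cons _ _ _); exact/val_inj.
Qed.

Lemma sqnorm_rV_cons n (t : R) (y : 'rV[R]_n) :
  sqnorm (rV_cons (t, y)) = t ^+ 2 + sqnorm y.
Proof.
rewrite /sqnorm /dotrV big_ord_recl rV_cons0 -expr2; congr (_ + _).
by apply: eq_bigr => i _; rewrite rV_consS.
Qed.

Lemma integral_expR_sqr_gt0 (c : R) : 0 < c ->
  (0 < \int[mu]_t (expR (- (c * t ^+ 2)))%:E)%E.
Proof.
move=> c0; have /integrableP[mg _] := integrable_expR_sqr c0.
have g0 t : (0 <= (expR (- (c * t ^+ 2)))%:E)%E by rewrite lee_fin expR_ge0.
apply: (@lt_le_trans _ _ (\int[mu]_(t in `[0%R, 1%R]) (expR (- c))%:E)%E).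
  have m01 : mu `[0%R, 1%R] = 1%E by rewrite lebesgue_measure_itv/= lte01 sube0.
  by rewrite integral_cst// [X in (_ * X)%E]m01 mule1 lte_fin expR_gt0.
apply: (@le_trans _ _ (\int[mu]_(t in `[0%R, 1%R]) (expR (- (c * t ^+ 2)))%:E)%E).
  apply: ge0_le_integral => //; first exact: measurable_funTS.
  move=> t /=; rewrite in_itv/= => /andP[t0 t1]; rewrite lee_fin ler_expR lerN2.
  by rewrite ler_piMr ?(ltW c0)// expr_le1.
exact: ge0_subset_integral.
Qed.

Lemma measurable_expR_sqnorm n (c : R) :
  measurable_fun setT (fun x : 'rV[R]_n => expR (c * sqnorm x)).
Proof.
apply: measurableT_comp => //.
by apply: measurable_funM => //; exact: measurable_sqnorm.
Qed.

Lemma measurable_expR_Nsqnorm n (c : R) :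
  measurable_fun setT (fun x : 'rV[R]_n => expR (- (c * sqnorm x))).
Proof. by under eq_fun do rewrite -mulNr; exact: measurable_expR_sqnorm. Qed.

Lemma integral_expR_sqnormS n (c : R) : 0 < c ->
  (\int[lebesgue_rV R n.+1]_x (expR (- (c * sqnorm x)))%:E =
   \int[mu]_t (expR (- (c * t ^+ 2)))%:E *
   \int[lebesgue_rV R n]_y (expR (- (c * sqnorm y)))%:E)%E.
Proof.
move=> c0; rewrite ge0_integral_lebesgue_rVS; last 2 first.
- by move=> x; rewrite lee_fin expR_ge0.
- by apply/measurable_EFinP; exact: measurable_expR_Nsqnorm.
have E t : (\int[lebesgue_rV R n]_y (expR (- (c * sqnorm (rV_cons (t, y)))))%:E =
    (expR (- (c * t ^+ 2)))%:E * \int[lebesgue_rV R n]_y (expR (- (c * sqnorm y)))%:E)%E.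
  rewrite -ge0_integralZl; [|by []
    |by apply/measurable_EFinP; exact: measurable_expR_Nsqnorm
    |by move=> y _; rewrite lee_fin expR_ge0|by rewrite lee_fin expR_ge0].
  by apply: eq_integral => y _ /=; rewrite sqnorm_rV_cons mulrDr opprD expRD -EFinM.
under eq_integral do rewrite E.
have mg := measurable_int _ (integrable_expR_sqr c0).
rewrite ge0_integralZr; [by []|by []|exact: mg
  |by move=> y _; rewrite lee_fin expR_ge0|].
by apply: integral_ge0 => y _; rewrite lee_fin expR_ge0.
Qed.

(** The lower bound gives the constant function 1 a nonzero norm in L^2(gamma). *)
Lemma integral_expR_sqnorm_bounds n (c : R) : 0 < c ->
  (0 < \int[lebesgue_rV R n]_x (expR (- (c * sqnorm x)))%:E < +oo)%E.
Proof.
move=> c0; elim: n => [|n /andP[IH0 IHoo]].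
  rewrite (_ : (fun=> _) = cst 1%E); last first.
    by apply/funext => x; rewrite /sqnorm /dotrV big_ord0 mulr0 oppr0 expR0.
  rewrite (_ : (\int[_]_x _)%E = (\int[dirac (0%R : 'rV[R]_0)]_x (cst 1%E) x)%E)//.
  by rewrite integral_dirac// diracT mul1e lte01 ltry.
rewrite integral_expR_sqnormS// mule_gt0//=; last exact: integral_expR_sqr_gt0.
apply: lte_mul_pinfty => //.
- exact: ltW (integral_expR_sqr_gt0 _).
- exact: (integrable_fin_num measurableT (integrable_expR_sqr c0)).
Qed.

Lemma integrable_expR_sqnorm n (c : R) : 0 < c ->
  (lebesgue_rV R n).-integrable setT (fun x => (expR (- (c * sqnorm x)))%:E).
Proof.
move=> c0; apply/integrableP; split.
  by apply/measurable_EFinP; exact: measurable_expR_Nsqnorm.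
under eq_integral do rewrite gee0_abs ?lee_fin ?expR_ge0//.
by have /andP[] := integral_expR_sqnorm_bounds n c0.
Qed.

End gaussian_decay.

(** * The space L^2 of the Gaussian measure *)

Section moderate.
Context (R : realType) (n : nat).
Local Notation gamma := (gaussian R n).
Implicit Types (f g h : 'rV[R]_n -> R).

Lemma sqnorm_ge0 (x : 'rV[R]_n) : 0 <= sqnorm x.
Proof. by apply: sumr_ge0 => i _; rewrite -expr2 sqr_ge0. Qed.

Lemma sqr_le_sqnorm (x : 'rV[R]_n) i : x 0 i ^+ 2 <= sqnorm x.
Proof.
rewrite /sqnorm /dotrV (bigD1 i)//= -expr2 lerDl.
by apply: sumr_ge0 => j _; rewrite -expr2 sqr_ge0.
Qed.

(** The density decays like exp(- |x|^2 / 2), hence the bound on the rate. *)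
Lemma integrable_gaussian_expR f (c C : R) : c < 2^-1 -> measurable_fun setT f ->
  (forall x, `|f x| <= C * expR (c * sqnorm x)) ->
  gamma.-integrable setT (EFin \o f).
Proof.
move=> c2 mf fC; apply/integrable_gaussian => //.
have c0 : 0 < 2^-1 - c by rewrite subr_gt0.
pose K := C * (2 * pi) `^ (- (n%:R / 2)).
apply: (@le_integrable _ _ _ _ _ _ _
   (fun x => K%:E * (expR (- ((2^-1 - c) * sqnorm x)))%:E)%E) => //.
- by apply/measurable_EFinP/measurable_funM => //; exact: measurable_gaussian_pdf.
- move=> x _; rewrite -EFinM !abse_EFin lee_fin.
  apply: (le_trans _ (ler_norm _)).
  rewrite normrM (gtr0_norm (gaussian_pdf_gt0 x)) /=.
  rewrite [leRHS](_ : _ = C * expR (c * sqnorm x) * gaussian_pdf x).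
    exact: ler_wpM2r (ltW (gaussian_pdf_gt0 x)) _ _ (fC x).
  have -> : - ((2^-1 - c) * sqnorm x) = c * sqnorm x + - (sqnorm x / 2) by ring.
  by rewrite expRD /K /gaussian_pdf; ring.
- by apply: integrableZl => //; exact: integrable_expR_sqnorm.
Qed.

(** Growth slower than every Gaussian: a class that contains the polynomials, is
    closed under products, and consists of square-integrable functions. *)
Definition moderate f := measurable_fun setT f /\
  forall e : R, 0 < e -> exists C : R, forall x, `|f x| <= C * expR (e * sqnorm x).

Lemma expR_sqnorm_ge1 (e : R) (x : 'rV[R]_n) : 0 <= e -> 1 <= expR (e * sqnorm x).
Proof. by move=> e0; rewrite -expR0 ler_expR mulr_ge0// sqnorm_ge0. Qed.

Lemma moderate_cst (c : R) : moderate (cst c).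
Proof.
split=> // e e0; exists `|c| => x /=.
by rewrite ler_peMr// expR_sqnorm_ge1// ltW.
Qed.

Lemma moderate_coord i : moderate (fun x => x 0 i).
Proof.
split; first exact: measurable_coord.
move=> e e0; exists (1 + e^-1) => x.
have e1 : 0 < e^-1 by rewrite invr_gt0.
have h1 : `|x 0 i| <= 1 + sqnorm x.
  have := sqr_le_sqnorm x i; rewrite -(real_normK (num_real (x 0 i))).
  by have := sqr_ge0 (`|x 0 i| - 1); have := normr_ge0 (x 0 i); nra.
apply: (le_trans h1); have h2 := expR_ge1Dx (e * sqnorm x).
have h3 := expR_sqnorm_ge1 x (ltW e0).
have h4 : sqnorm x = e^-1 * (e * sqnorm x) by rewrite mulrA mulVf ?mul1r// gt_eqF.
rewrite {1}h4 mulrDl mul1r; apply: lerD => //.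
by rewrite ler_pM2l//; apply: le_trans h2; rewrite lerDr.
Qed.

Lemma moderateD f g : moderate f -> moderate g -> moderate (f \+ g).
Proof.
move=> [mf hf] [mg hg]; split; first exact: measurable_funD.
move=> e e0; have [C fC] := hf e e0; have [D gD] := hg e e0.
exists (C + D) => x; rewrite mulrDl; apply: (le_trans (ler_normD _ _)).
exact: lerD.
Qed.

Lemma moderateM f g : moderate f -> moderate g -> moderate (f \* g).
Proof.
move=> [mf hf] [mg hg]; split; first exact: measurable_funM.
move=> e e0; have e2 : 0 < e / 2 by rewrite divr_gt0.
have [C fC] := hf _ e2; have [D gD] := hg _ e2.
exists (C * D) => x /=; rewrite normrM.
have -> : e * sqnorm x = e / 2 * sqnorm x + e / 2 * sqnorm x by field.
rewrite expRD mulrACA; exact: ler_pM.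
Qed.

Definition L2 f := measurable_fun setT f /\
  gamma.-integrable setT (EFin \o (fun x => f x ^+ 2)).

Lemma L2P f : (f \in L2gauss (R := R) (n := n)) <-> L2 f.
Proof.
split=> [fL|[mf if2]].
  split; last exact: Lfun2_integrable_sqr.
  by move: fL; rewrite inE => /andP[+ _]; rewrite inE.
rewrite inE; apply/andP; split; rewrite inE//= /finite_norm unlock /Lnorm.
apply: poweR_lty; move/integrableP: if2 => [_]; apply: le_lt_trans.
rewrite le_eqVlt; apply/orP; left; apply/eqP; apply: eq_integral => x _ /=.
by rewrite powR_mulrn// normrX.
Qed.

(** Squaring doubles the rate of growth of [h], which leaves it below 1/2; the
    factor [f] takes only an arbitrarily small part of the remaining margin. *)
Lemma L2_moderate_expR f h (c C : R) : c < 4^-1 -> moderate f ->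
  measurable_fun setT h -> (forall x, `|h x| <= C * expR (c * sqnorm x)) ->
  L2 (f \* h).
Proof.
move=> c4 [mf hf] mh hC; split; first exact: measurable_funM.
pose e := (4^-1 - c) / 2; have e0 : 0 < e by rewrite /e divr_gt0// subr_gt0.
have [D fD] := hf e e0.
apply: (@integrable_gaussian_expR _ (2 * (e + c)) ((D * C) ^+ 2)).
- by rewrite /e; lra.
- by apply: measurable_funX; exact: measurable_funM.
move=> x /=; rewrite normrX normrM.
have -> : expR (2 * (e + c) * sqnorm x) = (expR (e * sqnorm x) * expR (c * sqnorm x)) ^+ 2.
  by rewrite -expRD -expRM_natl; congr expR; ring.
have fh : `|f x| * `|h x| <= D * C * (expR (e * sqnorm x) * expR (c * sqnorm x)).
  by rewrite mulrACA; exact: ler_pM.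
by rewrite -exprMn lerXn2r ?nnegrE ?(le_trans _ fh)// mulr_ge0.
Qed.

Lemma L2_moderate f : moderate f -> L2 f.
Proof.
move=> mf; have := @L2_moderate_expR f (cst 1) 0 1.
have -> : f \* cst 1 = f by apply/funext => x /=; rewrite mulr1.
by apply => //= x; rewrite mul0r expR0 mulr1 normr1.
Qed.

Lemma L2D f g : L2 f -> L2 g -> L2 (f \+ g).
Proof.
move=> [mf f2] [mg g2]; have mfg := measurable_funD mf mg; split=> //.
apply: (@le_integrable _ _ _ _ _ _ _ (EFin \o (fun x => 2 * f x ^+ 2 + 2 * g x ^+ 2))) => //.
- by apply/measurable_EFinP; exact: measurable_funX.
- move=> x _; rewrite !abse_EFin lee_fin /= normrX real_normK ?num_real//.
  rewrite (ger0_norm (addr_ge0 (mulr_ge0 _ (sqr_ge0 _)) (mulr_ge0 _ (sqr_ge0 _))))//.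
  by have := sqr_ge0 (f x - g x); nra.
- have : gamma.-integrable setT
     ((fun x => 2%:E * (f x ^+ 2)%:E)%E \+ (fun x => 2%:E * (g x ^+ 2)%:E)%E).
    by apply: integrableD => //; exact: integrableZl.
  exact.
Qed.

Lemma L2_bounded h f (C : R) : measurable_fun setT h -> (forall x, `|h x| <= C) -> L2 f ->
  L2 (h \* f).
Proof.
move=> mh hC [mf f2]; split; first exact: measurable_funM.
apply: (@le_integrable _ _ _ _ _ _ _ (fun x => (C ^+ 2)%:E * (f x ^+ 2)%:E)%E) => //.
- by apply/measurable_EFinP/measurable_funX/measurable_funM.
- move=> x _; rewrite -EFinM !abse_EFin lee_fin /= exprMn normrM [leRHS]normrM.
  apply: ler_wpM2r => //; rewrite !normrX lerXn2r ?nnegrE//.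
  exact: le_trans (hC x) (ler_norm _).
- exact: integrableZl.
Qed.

Lemma L2Z (c : R) f : L2 f -> L2 (c \*o f).
Proof. by move=> lf; apply: (@L2_bounded (cst c) f `|c|). Qed.

Lemma L2N f : L2 f -> L2 (\- f).
Proof.
move=> lf; have -> : \- f = -1 \*o f by apply/funext => x /=; rewrite mulN1r.
exact: L2Z.
Qed.

Lemma L2B f g : L2 f -> L2 g -> L2 (f \- g).
Proof. by move=> lf lg; apply: L2D => //; exact: L2N. Qed.

Lemma L2_integrableM f g : L2 f -> L2 g -> gamma.-integrable setT (EFin \o (fun x => f x * g x)).
Proof.
move=> lf lg; have [mf f2] := lf; have [mg g2] := lg.
apply: (@le_integrable _ _ _ _ _ _ _ (EFin \o (fun x => f x ^+ 2 + g x ^+ 2))) => //.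
- by apply/measurable_EFinP/measurable_funM.
- move=> x _; rewrite !abse_EFin lee_fin /= (ger0_norm (addr_ge0 _ _)) ?sqr_ge0//.
  rewrite normrM -(real_normK (num_real (f x))) -(real_normK (num_real (g x))).
  by have := normr_ge0 (f x); have := normr_ge0 (g x); have := sqr_ge0 (`|f x| - `|g x|); nra.
- have : gamma.-integrable setT
     ((fun x => (f x ^+ 2)%:E)%E \+ (fun x => (g x ^+ 2)%:E)%E) by exact: integrableD.
  exact.
Qed.

Definition ip f g : R := \int[gamma]_x (f x * g x).

Lemma ipC f g : ip f g = ip g f.
Proof. by apply: eq_Rintegral => x _; rewrite mulrC. Qed.

Lemma ipDl f g h : L2 f -> L2 g -> L2 h -> ip (f \+ g) h = ip f h + ip g h.
Proof.
move=> lf lg lh; rewrite /ip -RintegralD//; try exact: L2_integrableM.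
by apply: eq_Rintegral => x _ /=; rewrite mulrDl.
Qed.

Lemma ipBl f g h : L2 f -> L2 g -> L2 h -> ip (f \- g) h = ip f h - ip g h.
Proof.
move=> lf lg lh; rewrite /ip -RintegralB//; try exact: L2_integrableM.
by apply: eq_Rintegral => x _ /=; rewrite mulrBl.
Qed.

Lemma ipZl c f h : L2 f -> L2 h -> ip (c \*o f) h = c * ip f h.
Proof.
move=> lf lh; rewrite /ip -RintegralZl//; try exact: L2_integrableM.
by apply: eq_Rintegral => x _ /=; rewrite mulrA.
Qed.

Lemma ipDr f g h : L2 f -> L2 g -> L2 h -> ip h (f \+ g) = ip h f + ip h g.
Proof. by move=> *; rewrite ipC ipDl// !(ipC _ h). Qed.

Lemma ipBr f g h : L2 f -> L2 g -> L2 h -> ip h (f \- g) = ip h f - ip h g.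
Proof. by move=> *; rewrite ipC ipBl// !(ipC _ h). Qed.

Lemma ipZr c f h : L2 f -> L2 h -> ip h (c \*o f) = c * ip h f.
Proof. by move=> *; rewrite ipC ipZl// !(ipC _ h). Qed.

Lemma ip_ge0 f : 0 <= ip f f.
Proof. by apply: Rintegral_ge0 => x _; rewrite -expr2 sqr_ge0. Qed.

Lemma sqL2E f : L2 f -> sqL2 f = (ip f f)%:E.
Proof.
move=> lf; rewrite /sqL2 /ip /Rintegral fineK; first by [].
apply: integrable_fin_num => //; exact: L2_integrableM.
Qed.

Lemma ip_eq0_ae f : L2 f -> ip f f = 0 -> {ae gamma, forall x, f x = 0}.
Proof.
move=> lf f0; have : sqL2 f = 0%E by rewrite sqL2E// f0.
rewrite /sqL2 => h; have [mf _] := lf.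
have m2 : measurable_fun setT (fun x => ((f x) ^+ 2)%:E).
  by apply/measurable_EFinP; exact: measurable_funX.
have : (\int[gamma]_x `| ((f x) ^+ 2)%:E | = 0)%E.
  by rewrite -[RHS]h; apply: eq_integral => x _; rewrite gee0_abs// lee_fin sqr_ge0.
move/(ae_eq_integral_abs gamma measurableT m2); apply: filterS => x /= /(_ I).
by move=> [] /eqP; rewrite sqrf_eq0 => /eqP.
Qed.

Lemma ip_ae f g h : measurable_fun setT f -> measurable_fun setT g ->
  measurable_fun setT h ->
  {ae gamma, forall x, f x = g x} -> ip f h = ip g h.
Proof.
move=> mf mg mh fg; rewrite /ip /Rintegral; congr fine; apply: ae_eq_integral => //.
- by apply/measurable_EFinP; exact: measurable_funM.
- by apply/measurable_EFinP; exact: measurable_funM.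
- by apply: filterS fg => x /= -> _.
Qed.

Lemma ip_eq0r f h : L2 f -> L2 h -> ip h h = 0 -> ip f h = 0.
Proof.
move=> lf lh /(ip_eq0_ae lh) h0; have [mf _] := lf; have [mh _] := lh.
rewrite ipC (@ip_ae _ (cst 0))//.
by rewrite /ip; under eq_Rintegral do rewrite mul0r; rewrite /Rintegral integral0.
Qed.

Lemma ip11_gt0 : 0 < ip (cst 1) (cst 1).
Proof.
rewrite -lte_fin -sqL2E; last by apply/L2_moderate/moderate_cst.
rewrite /sqL2 integral_gaussian; last exact: measurable_funX.
have h2 : (0 < 2^-1 :> R) by [].
have /andP[I0 _] := integral_expR_sqnorm_bounds n h2.
have K0 : 0 < (2 * pi) `^ (- (n%:R / 2)) :> R by rewrite powR_gt0// mulr_gt0 ?pi_gt0.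
rewrite [ltRHS](_ : _ = \int[lebesgue_rV R n]_x
  (((2 * pi) `^ (- (n%:R / 2)))%:E * (expR (- (2^-1 * sqnorm x)))%:E))%E; last first.
  apply: eq_integral => x _ /=.
  by rewrite expr1n mul1r /gaussian_pdf -EFinM (mulrC 2^-1).
rewrite ge0_integralZl; [|by []
    |by apply/measurable_EFinP; exact: measurable_expR_Nsqnorm
    |by move=> y _; rewrite lee_fin expR_ge0|by rewrite lee_fin ltW].
by rewrite mule_gt0.
Qed.

End moderate.

(** * Polynomials are dense *)

Section exponential_sums.
Context (R : realType).
Implicit Types x y : R.

Definition exp_sum (k : nat) x : R := \sum_(j < k) x ^+ j / j`!%:R.

Lemma exp_sumE k x : exp_sum k x = series (exp_coeff x) k.
Proof. by rewrite /exp_sum /series/= big_mkord. Qed.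

Lemma exp_sum_cvg x : exp_sum k x @[k --> \oo] --> expR x.
Proof.
under eq_fun do rewrite exp_sumE; exact: is_cvg_series_exp_coeff.
Qed.

(** Uniformity in [k] makes the right-hand side a dominating function. *)
Lemma exp_sum_bound k x : `|exp_sum k x| <= expR `|x|.
Proof.
apply: (@le_trans _ _ (exp_sum k `|x|)).
  apply: (le_trans (ler_norm_sum _ _ _)); apply: ler_sum => j _.
  by rewrite normrM normfV normrX (ger0_norm (ler0n _ _)).
rewrite exp_sumE; apply: nondecreasing_cvgn_le; last exact: is_cvg_series_exp_coeff.
apply/nondecreasing_seqP => j; rewrite /series/= big_nat_recr//= lerDl.
exact: exp_coeff_ge0.
Qed.

End exponential_sums.

Section polynomials.
Context (R : realType) (n : nat).
Implicit Types (f g h p : 'rV[R]_n -> R).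

Definition mulX (i : 'I_n) f : 'rV[R]_n -> R := fun x => x 0 i * f x.

(** The polynomial functions of degree at most [m], generated so that facts about
    them go by induction on the degree. *)
Inductive Pol : nat -> ('rV[R]_n -> R) -> Prop :=
| Pol_cst m c : Pol m (cst c)
| Pol_mulX m i f : Pol m f -> Pol m.+1 (mulX i f)
| PolD m f g : Pol m f -> Pol m g -> Pol m (f \+ g).

Lemma Pol_leq m k f : (m <= k)%N -> Pol m f -> Pol k f.
Proof.
move=> mk pf; elim: pf k mk => {m f} [m c|m i f _ IH|m f g _ IHf _ IHg] k mk.
- exact: Pol_cst.
- by case: k mk => // k mk; apply: Pol_mulX; exact: IH.
- by apply: PolD; [exact: IHf|exact: IHg].
Qed.

Lemma PolZ m c f : Pol m f -> Pol m (c \*o f).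
Proof.
elim => {m f} [m d|m i f _ IH|m f g _ IHf _ IHg].
- rewrite (_ : c \*o cst d = cst (c * d)); first exact: Pol_cst.
  by apply/funext.
- have -> : c \*o mulX i f = mulX i (c \*o f); last exact: Pol_mulX.
  by apply/funext => x; rewrite /= /mulX mulrCA.
- have -> : c \*o (f \+ g) = (c \*o f) \+ (c \*o g); last exact: PolD.
  by apply/funext => x; rewrite /= mulrDr.
Qed.

Lemma PolB m f g : Pol m f -> Pol m g -> Pol m (f \- g).
Proof.
move=> pf pg; have -> : f \- g = f \+ (-1 \*o g).
  by apply/funext => x /=; rewrite mulN1r.
by apply: PolD => //; exact: PolZ.
Qed.

Lemma Pol_coord i : Pol 1 (fun x => x 0 i).
Proof.
have -> : (fun x : 'rV[R]_n => x 0 i) = mulX i (cst 1).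
  by apply/funext => x; rewrite /mulX mulr1.
by apply: Pol_mulX; exact: Pol_cst.
Qed.

Lemma PolM m k f g : Pol m f -> Pol k g -> Pol (m + k) (f \* g).
Proof.
move=> pf; elim: pf k g => {m f} [m c|m i f _ IH|m f1 f2 _ IHf _ IHg] k g pg.
- by apply: (@Pol_leq k); [exact: leq_addl|exact: PolZ].
- have -> : mulX i f \* g = mulX i (f \* g).
    by apply/funext => x; rewrite /= /mulX mulrA.
  by apply: Pol_mulX; exact: IH.
- have -> : (f1 \+ f2) \* g = (f1 \* g) \+ (f2 \* g).
    by apply/funext => x; rewrite /= mulrDl.
  by apply: PolD; [exact: IHf|exact: IHg].
Qed.

Lemma Pol_sum m I (r : seq I) (F : I -> 'rV[R]_n -> R) :
  (forall i, Pol m (F i)) -> Pol m (fun x => \sum_(i <- r) F i x).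
Proof.
move=> pF; elim: r => [|i r IH].
  rewrite (_ : (fun x => _) = cst 0); first exact: Pol_cst.
  by apply/funext => x; rewrite big_nil.
rewrite (_ : (fun x => _) = F i \+ (fun x => \sum_(i <- r) F i x)).
  exact: PolD.
by apply/funext => x; rewrite big_cons.
Qed.

Lemma Pol_moderate m f : Pol m f -> moderate f.
Proof.
elim => {m f} [m c|m i f _ IH|m f g _ IHf _ IHg].
- exact: moderate_cst.
- exact: (moderateM (moderate_coord _ i) IH).
- exact: moderateD.
Qed.

Lemma Pol_L2 m f : Pol m f -> L2 f.
Proof. by move=> /Pol_moderate; exact: L2_moderate. Qed.

End polynomials.

Section polynomial_density.
Context (R : realType) (n : nat).
Local Notation gamma := (gaussian R n).
Implicit Types (f g h p : 'rV[R]_n -> R).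

Lemma L2_le f g : measurable_fun setT f -> (forall x, `|f x| <= `|g x|) -> L2 g -> L2 f.
Proof.
move=> mf fg [mg g2]; split => //.
apply: (@le_integrable _ _ _ _ _ _ _ (EFin \o (fun x => g x ^+ 2))) => //.
- by apply/measurable_EFinP; exact: measurable_funX.
- by move=> x _; rewrite !abse_EFin lee_fin /= !normrX lerXn2r ?nnegrE.
Qed.

Lemma cvg_norm_le (a : nat -> R) (l C : R) :
  a k @[k --> \oo] --> l -> (forall k, `|a k| <= C) -> `|l| <= C.
Proof. by move=> al aC; apply: (cvgr_to_le (cvg_norm al)); exact: nearW. Qed.

Lemma ip_sqrD f g : L2 f -> L2 g -> ip (f \+ g) (f \+ g) <= 2 * ip f f + 2 * ip g g.
Proof.
move=> lf lg.
have : 0 <= ip (f \- g) (f \- g) by exact: ip_ge0.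
have lB := L2B lf lg; have lD := L2D lf lg.
rewrite ipBl// !ipBr// ipDl// !ipDr// (ipC g f); lra.
Qed.

Lemma ip_dominated_cvg (f_ : nat -> 'rV[R]_n -> R) f g :
  (forall k, measurable_fun setT (f_ k)) -> measurable_fun setT f ->
  (forall x, f_ k x @[k --> \oo] --> f x) ->
  (forall k x, `|f_ k x| <= `|g x|) -> L2 g ->
  ip (f \- f_ k) (f \- f_ k) @[k --> \oo] --> 0.
Proof.
move=> mf_ mf cf fg lg; have [mg g2] := lg.
have fg' x : `|f x| <= `|g x|.
  by apply: cvg_norm_le (cf x) _ => k.
have -> : 0 = \int[gamma]_x (cst 0 x) :> R by rewrite /Rintegral integral0.
rewrite /ip; apply: (@Rintegral_dominated_cvg _ _ _ _ _ _ (fun x => 4 * g x ^+ 2)) => //.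
- by move=> k; apply: measurable_funM; exact: measurable_funB.
- move=> x; have h : f x - f_ k x @[k --> \oo] --> (0 : R).
    by rewrite -(subrr (f x)); apply: cvgB => //; exact: cvg_cst.
  by rewrite /= -[X in _ --> X](mulr0 0); exact: cvgM.
- by rewrite (_ : EFin \o _ = fun x => 4%:E * (g x ^+ 2)%:E)%E//; exact: integrableZl.
- move=> k x /=; rewrite -expr2 normrX.
  have h : `|f x - f_ k x| <= 2 * `|g x|.
    apply: (le_trans (ler_normB _ _)); rewrite mulr_natl mulr2n.
    exact: lerD.
  rewrite -(real_normK (num_real (g x))).
  have := normr_ge0 (f x - f_ k x); have := normr_ge0 (g x); nra.
Qed.

(** The closure of the polynomials in L^2(gamma). *)
Definition approx f := L2 f /\
  forall e : R, 0 < e -> exists m p, Pol m p /\ ip (f \- p) (f \- p) < e.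

Lemma approx_Pol m p : Pol m p -> approx p.
Proof.
move=> pp; split; first exact: Pol_L2 pp.
move=> e e0; exists m, p; split=> //.
rewrite (_ : p \- p = cst 0); last by apply/funext => x /=; rewrite subrr.
by rewrite /ip /=; under eq_Rintegral do rewrite mul0r; rewrite /Rintegral integral0.
Qed.

Lemma approx_closed f : L2 f ->
  (forall e : R, 0 < e -> exists2 g, approx g & ip (f \- g) (f \- g) < e) -> approx f.
Proof.
move=> lf h; split => // e e0.
have e4 : 0 < e / 4 by rewrite divr_gt0.
have [g [lg ag] fg] := h _ e4; have [m [p [pp gp]]] := ag _ e4.
have lp := Pol_L2 pp.
exists m, p; split => //.
have -> : f \- p = (f \- g) \+ (g \- p).
  by apply/funext => x /=; rewrite addrA subrK.
apply: le_lt_trans (ip_sqrD (L2B lf lg) (L2B lg lp)) _; lra.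
Qed.

Lemma approx_cvg (f_ : nat -> 'rV[R]_n -> R) f g :
  (forall k, approx (f_ k)) -> (forall x, f_ k x @[k --> \oo] --> f x) ->
  (forall k x, `|f_ k x| <= `|g x|) -> L2 g -> approx f.
Proof.
move=> af cf fg lg.
have mf_ k : measurable_fun setT (f_ k) by case: (af k) => -[].
have mf : measurable_fun setT f by apply: (measurable_fun_cvg mf_) => x _.
have lf : L2 f.
  by apply: (L2_le mf _ lg) => x; apply: cvg_norm_le (cf x) _ => k.
apply: approx_closed => // e e0.
have /cvgrPdist_lt/(_ _ e0) [k _ /(_ k (leqnn _))/=] := ip_dominated_cvg mf_ mf cf fg lg.
by rewrite sub0r normrN ger0_norm ?ip_ge0// => h; exists (f_ k).
Qed.

Lemma approxD f g : approx f -> approx g -> approx (f \+ g).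
Proof.
move=> [lf af] [lg ag]; split; first exact: L2D.
move=> e e0; have e4 : 0 < e / 4 by rewrite divr_gt0.
have [m [p [pp hp]]] := af _ e4; have [k [q [pq hq]]] := ag _ e4.
exists (maxn m k), (p \+ q); split.
  by apply: PolD; [exact: Pol_leq (leq_maxl _ _) pp|exact: Pol_leq (leq_maxr _ _) pq].
have -> : (f \+ g) \- (p \+ q) = (f \- p) \+ (g \- q).
  by apply/funext => x /=; rewrite opprD addrACA.
have lp := Pol_L2 pp; have lq := Pol_L2 pq.
apply: le_lt_trans (ip_sqrD (L2B lf lp) (L2B lg lq)) _; lra.
Qed.

(** Multiplication by a bounded function is continuous in L^2, so that it is enough
    to control it on the polynomials. *)
Lemma approx_bounded_mul h (C : R) f : measurable_fun setT h -> (forall x, `|h x| <= C) ->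
  (forall m p, Pol m p -> approx (h \* p)) -> approx f -> approx (h \* f).
Proof.
move=> mh hC ah [lf af]; have lhf := L2_bounded mh hC lf; apply: approx_closed => // e e0.
have C0 : 0 < C ^+ 2 + 1 by rewrite ltr_wpDl// sqr_ge0.
have [m [p [pp hp]]] := af (e / (C ^+ 2 + 1)) (divr_gt0 e0 C0).
have lp := Pol_L2 pp.
exists (h \* p); first exact: ah pp.
have lfp := L2B lf lp; have lhfp := L2_bounded mh hC lfp.
have -> : (h \* f) \- (h \* p) = h \* (f \- p).
  by apply/funext => x /=; rewrite mulrBr.
have h1 : ip (h \* (f \- p)) (h \* (f \- p)) <= C ^+ 2 * ip (f \- p) (f \- p).
  rewrite -ipZl// /ip; apply: le_Rintegral => //; try exact: L2_integrableM.
    by apply: L2_integrableM => //; exact: L2Z.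
  move=> x _ /=.
  have := hC x; have := normr_ge0 (h x); move=> h0 hc.
  rewrite mulrACA -[leRHS]mulrA -!expr2.
  apply: ler_wpM2r; first exact: sqr_ge0.
  by rewrite -(real_normK (num_real (h x))) lerXn2r ?nnegrE// (le_trans h0 hc).
apply: (le_lt_trans h1); move: hp; rewrite ltr_pdivlMr// mulrDr mulr1 mulrC.
by have := ip_ge0 (f \- p); lra.
Qed.

(** Since the multipliers form an algebra closed under bounded pointwise limits, the
    sets whose indicators are multipliers form a sigma-algebra; it is then enough to
    produce the indicators of a generating family. *)
Definition multiplier h := [/\ measurable_fun setT h, exists C : R, forall x, `|h x| <= C
  & forall f, approx f -> approx (h \* f)].

Lemma multiplier_Pol h (C : R) : measurable_fun setT h -> (forall x, `|h x| <= C) ->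
  (forall m p, Pol m p -> approx (h \* p)) -> multiplier h.
Proof.
move=> mh hC ah; split => //; first by exists C.
by move=> f; exact: approx_bounded_mul hC ah.
Qed.

Lemma multiplier_cst c : multiplier (cst c).
Proof.
apply: (@multiplier_Pol _ `|c|) => // m p pp.
by apply: (@approx_Pol m); exact: PolZ.
Qed.

Lemma multiplierM g h : multiplier g -> multiplier h -> multiplier (g \* h).
Proof.
move=> [mg [C gC] ag] [mh [D hD] ah]; split; first exact: measurable_funM.
  by exists (C * D) => x /=; rewrite normrM ler_pM.
move=> f af; have -> : (g \* h) \* f = g \* (h \* f).
  by apply/funext => x /=; rewrite mulrA.
by apply: ag; exact: ah.
Qed.

Lemma multiplierD g h : multiplier g -> multiplier h -> multiplier (g \+ h).
Proof.
move=> [mg [C gC] ag] [mh [D hD] ah]; split; first exact: measurable_funD.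
  by exists (C + D) => x /=; rewrite (le_trans (ler_normD _ _))// lerD.
move=> f af; have -> : (g \+ h) \* f = (g \* f) \+ (h \* f).
  by apply/funext => x /=; rewrite mulrDl.
by apply: approxD; [exact: ag|exact: ah].
Qed.

Lemma multiplierZ c h : multiplier h -> multiplier (c \*o h).
Proof. by move=> ?; apply: multiplierM => //; exact: multiplier_cst. Qed.

Lemma multiplier_cvg (h_ : nat -> 'rV[R]_n -> R) h (C : R) :
  (forall k, multiplier (h_ k)) -> (forall k x, `|h_ k x| <= C) ->
  (forall x, h_ k x @[k --> \oo] --> h x) -> multiplier h.
Proof.
move=> Mh hC ch.
have mh_ k : measurable_fun setT (h_ k) by case: (Mh k).
have mh : measurable_fun setT h by apply: (measurable_fun_cvg mh_) => x _.
have hC' x : `|h x| <= C.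
  by apply: cvg_norm_le (ch x) _ => k.
split=> //; first by exists C.
move=> f af; have [lf _] := af.
apply: (@approx_cvg (fun k => h_ k \* f) _ (C \*o f)).
- by move=> k; case: (Mh k) => _ _; apply.
- by move=> x; apply: cvgMl; exact: ch.
- by move=> k x /=; rewrite !normrM ler_wpM2r// (le_trans (hC _ _))// ler_norm.
- exact: L2Z.
Qed.

Lemma multiplier_exp_sum h k : multiplier h -> multiplier (fun x => exp_sum k (h x)).
Proof.
move=> Mh; elim: k => [|k IH].
  rewrite (_ : (fun x => _) = cst 0); first exact: multiplier_cst.
  by apply/funext => x; rewrite /exp_sum big_ord0.
rewrite (_ : (fun x => _) =
  (fun x => exp_sum k (h x)) \+ (k`!%:R^-1 \*o (fun x => h x ^+ k))); last first.
  by apply/funext => x; rewrite /exp_sum big_ord_recr/= mulrC.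
apply: multiplierD => //; apply: multiplierZ.
elim: k {IH} => [|k IH]; first exact: multiplier_cst.
rewrite (_ : (fun x => _) = h \* (fun x => h x ^+ k)); first exact: multiplierM.
by apply/funext => x; rewrite exprS.
Qed.

(** The bound on [h] bounds its exponential sums uniformly. *)
Lemma multiplier_expR h : multiplier h -> multiplier (expR \o h).
Proof.
move=> Mh; have [mh [C hC] _] := Mh.
apply: (@multiplier_cvg (fun k x => exp_sum k (h x)) _ (expR C)).
- by move=> k; exact: multiplier_exp_sum.
- by move=> k x; rewrite (le_trans (exp_sum_bound _ _))// ler_expR.
- by move=> x; exact: exp_sum_cvg.
Qed.

Lemma expRN_le (y : R) : 0 <= y -> expR (- y) <= (1 + y)^-1.
Proof.
move=> y0; rewrite expRN lef_pV2 ?posrE ?expR_gt0 ?expR_ge1Dx//.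
by rewrite ltr_pwDl.
Qed.

(** The indicator of the positivity set of h is the limit of exp(- k exp(- k h)):
    k exp(- k h) tends to 0 when h > 0, and is at least k when h <= 0. *)
Lemma multiplier_indic_gt0 h : multiplier h -> multiplier (\1_[set x | 0 < h x]).
Proof.
move=> Mh; apply: (@multiplier_cvg (fun k x => expR (- k.+1%:R * expR (- k.+1%:R * h x))) _ 1).
- move=> k; apply: (@multiplier_expR (- k.+1%:R \*o _)); apply: multiplierZ.
  by apply: (@multiplier_expR (- k.+1%:R \*o h)); exact: multiplierZ.
- move=> k x; rewrite ger0_norm ?expR_ge0// -[leRHS]expR0 ler_expR mulNr oppr_le0.
move=> x; rewrite indicE; case: (ltP 0 (h x)) => hx.
  rewrite mem_set//=.
  rewrite -[X in _ --> X]expR0; apply: continuous_cvg; first exact: continuous_expR.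
  under eq_fun do rewrite mulNr; rewrite -oppr0; apply: cvgN.
  apply: (@squeeze_cvgr _ _ _ _ (cst 0) (fun k => 4 / h x ^+ 2 * harmonic k)).
  - apply: nearW => k; rewrite mulr_ge0 ?expR_ge0//= mulNr.
    (* Half of the exponent is kept to spare: exp(- y) <= (1 + y)^-1 is used
       squared, so as to beat the factor k + 1. *)
    have -> : k.+1%:R * h x = 2 * (k.+1%:R * h x / 2) by field.
    rewrite -mulrN expRM_natl.
    have y0 : 0 <= k.+1%:R * h x / 2 by rewrite divr_ge0// mulr_ge0// ltW.
    have k0 : k.+1%:R != 0 :> R by rewrite pnatr_eq0.
    apply: (@le_trans _ _ (k.+1%:R * ((k.+1%:R * h x / 2)^-1) ^+ 2)).
      apply: ler_wpM2l => //; rewrite lerXn2r ?nnegrE ?expR_ge0 ?invr_ge0//.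
      apply: (le_trans (expRN_le y0)); rewrite lef_pV2 ?posrE.
      - by rewrite lerDr.
      - by rewrite ltr_pwDl.
      - by rewrite divr_gt0// mulr_gt0.
    rewrite le_eqVlt; apply/orP; left; apply/eqP; rewrite /harmonic/=.
    by field; rewrite nat1r k0 gt_eqF.
  - exact: cvg_cst.
  - rewrite -[X in _ --> X](mulr0 (4 / h x ^+ 2)); apply: cvgM; [exact: cvg_cst|exact: cvg_harmonic].
rewrite memNset/=; last by apply/negP; rewrite -leNgt.
apply: (@squeeze_cvgr _ _ _ _ (cst 0) harmonic).
- apply: nearW => k; rewrite expR_ge0/= mulNr.
  have k0 : 0 <= k.+1%:R :> R by [].
  have h1 : k.+1%:R <= k.+1%:R * expR (- k.+1%:R * h x).
    rewrite ler_peMr// -[leLHS]expR0 ler_expR mulNr oppr_ge0; exact: mulr_ge0_le0.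
  rewrite (le_trans (expRN_le (le_trans k0 h1)))// lef_pV2 ?posrE//.
  by rewrite (le_trans h1)// lerDr.
- exact: cvg_cst.
- exact: cvg_harmonic.
Qed.

Lemma normM_expR_sqr_le (t : R) : `|t| * expR (- (t ^+ 2 / 8)) <= 8.
Proof.
rewrite expRN ler_pdivrMr ?expR_gt0//.
have h := expR_ge1Dx (t ^+ 2 / 8); apply: (@le_trans _ _ (8 * (1 + t ^+ 2 / 8))); last first.
  by rewrite ler_pM2l.
rewrite -(real_normK (num_real t)).
by have := normr_ge0 t; have := sqr_ge0 (`|t| - 1); nra.
Qed.

(** The Taylor polynomials of exp(-x_i^2/8) are dominated by exp(x_i^2/8), which is
    in L^2 for the Gaussian measure. *)
Lemma approx_Pol_expR i m p : Pol m p ->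
  approx (fun x => p x * expR (- (x 0 i ^+ 2 / 8))).
Proof.
move=> pp; pose q (x : 'rV[R]_n) : R := - (x 0 i ^+ 2 / 8).
have mq : measurable_fun setT q.
  apply: measurableT_comp => //; apply: measurable_funM => //.
  by apply: measurable_funX; exact: measurable_coord.
have Pq : Pol 2 q.
  have -> : q = (- 8^-1) \*o ((fun x => x 0 i) \* (fun x => x 0 i)).
    by apply/funext => x; rewrite /q/=; field.
  by apply: PolZ; apply: (@PolM _ _ 1 1); exact: Pol_coord.
have qX j : exists k, Pol k (fun x => q x ^+ j).
  elim: j => [|j [k IH]]; first by exists 0; exact: Pol_cst.
  exists (2 + k)%N; rewrite (_ : (fun x => _) = q \* (fun x => q x ^+ j)).
    exact: PolM.
  by apply/funext => x; rewrite exprS.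
apply: (@approx_cvg (fun k x => p x * exp_sum k (q x)) _ (fun x => p x * expR (`|q x|))).
- elim => [|k IH].
    apply: (@approx_Pol 0); rewrite (_ : (fun x => _) = cst 0); first exact: Pol_cst.
    by apply/funext => x; rewrite /exp_sum big_ord0 mulr0.
  rewrite (_ : (fun x => _) = (fun x => p x * exp_sum k (q x)) \+
      (p \* (k`!%:R^-1 \*o (fun x => q x ^+ k)))); last first.
    by apply/funext => x; rewrite /exp_sum big_ord_recr/= mulrDr [_ / _]mulrC.
  apply: approxD => //; have [j Pj] := qX k.
  by apply: approx_Pol; apply: PolM pp _; apply: PolZ; exact: Pj.
- by move=> x; apply: cvgM; [exact: cvg_cst|exact: exp_sum_cvg].
- move=> k x; rewrite !normrM ler_wpM2l// [leRHS]ger0_norm ?expR_ge0//.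
  exact: exp_sum_bound.
- apply: (@L2_moderate_expR _ _ _ (fun x => expR (`|q x|)) (8^-1) 1).
  + by rewrite ltf_pV2 ?posrE// ltr_nat.
  + exact: Pol_moderate pp.
  + by apply: measurableT_comp => //; exact: measurableT_comp.
  + move=> x; rewrite ger0_norm ?expR_ge0// mul1r ler_expR /q normrN ger0_norm.
      by rewrite mulrC ler_pM2l ?invr_gt0// sqr_le_sqnorm.
    by rewrite divr_ge0// sqr_ge0.
Qed.

(** The half-space is the positivity set of (x_i - a) exp(- x_i^2 / 8), a bounded
    function. *)
Lemma multiplier_halfspace i (a : R) :
  multiplier (\1_[set x : 'rV[R]_n | a < x 0 i]).
Proof.
pose h (x : 'rV[R]_n) := (x 0 i - a) * expR (- (x 0 i ^+ 2 / 8)).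
have -> : [set x : 'rV[R]_n | a < x 0 i] = [set x | 0 < h x].
  by apply/seteqP; split=> x /=; rewrite /h pmulr_lgt0 ?expR_gt0 ?subr_gt0.
apply: multiplier_indic_gt0; apply: (@multiplier_Pol _ (8 + `|a|)).
- apply: measurable_funM.
    by apply: measurable_funB => //; exact: measurable_coord.
  apply: measurableT_comp => //; apply: measurableT_comp => //.
  apply: measurable_funM => //.
  by apply: measurable_funX; exact: measurable_coord.
- move=> x; rewrite /h normrM [X in _ * X]ger0_norm ?expR_ge0//.
  apply: (@le_trans _ _ ((`|x 0 i| + `|a|) * expR (- (x 0 i ^+ 2 / 8)))).
    by rewrite ler_wpM2r ?expR_ge0// ler_normB.
  rewrite mulrDl lerD ?normM_expR_sqr_le//.
  rewrite ler_piMr// -[leRHS]expR0 ler_expR oppr_le0 divr_ge0// sqr_ge0.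
  by [].
- move=> m p pp; rewrite (_ : h \* p = (fun x => (((fun x : 'rV[R]_n => x 0 i) \- cst a) \* p) x *
      expR (- (x 0 i ^+ 2 / 8)))).
    apply: approx_Pol_expR; apply: (@PolM _ _ 1 m) => //.
    by apply: PolB; [exact: Pol_coord|exact: Pol_cst].
  by apply/funext => x; rewrite /h /=; ring.
Qed.

(** A countable union is the complement of the limit of the products of the
    indicators of the complements. *)
Lemma sigma_algebra_multiplier :
  sigma_algebra setT [set B : set 'rV[R]_n | multiplier (\1_B)].
Proof.
have MC B : multiplier (\1_B) -> multiplier (\1_(~` B)).
  move=> MB; have -> : \1_(~` B) = cst 1 \+ (-1 \*o \1_B) :> ('rV[R]_n -> R).
    apply/funext => x; rewrite /= !indicE in_setC mulN1r.
    by case: (x \in B); rewrite ?subrr ?subr0.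
  by apply: multiplierD; [exact: multiplier_cst|exact: multiplierZ].
split => /=.
- have -> : \1_set0 = cst 0 :> ('rV[R]_n -> R); last exact: multiplier_cst.
  by apply/funext => x; rewrite indicE in_set0.
- by move=> B MB; rewrite setTD; exact: MC.
move=> F MF.
have -> : \bigcup_k F k = ~` ~` (\bigcup_k F k) by rewrite setCK.
apply: (MC); pose g k (x : 'rV[R]_n) : R := \prod_(j < k) \1_(~` F j) x.
have Mg k : multiplier (g k).
  elim: k => [|k IH].
    rewrite (_ : g 0 = cst 1); first exact: multiplier_cst.
    by apply/funext => x; rewrite /g big_ord0.
  rewrite (_ : g k.+1 = g k \* \1_(~` F k)); first by apply: multiplierM => //; exact: MC.
  by apply/funext => x; rewrite /g big_ord_recr.
apply: (@multiplier_cvg g _ 1) => //.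
  move=> k x; rewrite /g normr_prod; apply: prodr_ile1 => j _.
  by rewrite normr_ge0/= indicE ger0_norm ?ler0n// lern1; case: (_ \in _).
move=> x; rewrite indicE in_setC.
have [/[!inE] xF|/negP xF] := boolP (x \in \bigcup_k F k).
  have [k _ Fk] := xF; apply: cvg_near_cst; exists k.+1 => // N /= kN.
  rewrite /g (bigD1 (Ordinal kN))//= indicE in_setC mem_set// mul0r//.
apply: cvg_near_cst; apply: nearW => N; rewrite /g big1// => j _.
rewrite indicE in_setC memNset// => Fj; apply: xF; rewrite inE.
by exists j.
Qed.

Lemma multiplier_indic (B : set 'rV[R]_n) : measurable B -> multiplier (\1_B).
Proof.
suff : g_sigma_preimage (fun i (x : 'rV[R]_n) => x 0 i : measurableTypeR R) `<=`
  [set B : set 'rV[R]_n | multiplier (\1_B)] by apply.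
apply: smallest_sub; first exact: sigma_algebra_multiplier.
rewrite -bigcup_seq => A [i _ [Y mY <-]] /=; rewrite setTI.
have [m0 mC mU] := sigma_algebra_multiplier.
pose S := [set Y : set R | multiplier (\1_((fun x : 'rV[R]_n => x 0 i) @^-1` Y))].
suff : (@RGenOInfty.G R).-sigma.-measurable `<=` S.
  by apply; rewrite -RGenOInfty.measurableE.
apply: smallest_sub; first split.
- by rewrite /S /= preimage_set0.
- by move=> Z SZ; rewrite /S /= setTD preimage_setC -setTD; exact: mC.
- by move=> F SF; rewrite /S /= preimage_bigcup; exact: mU.
move=> _ [a ->]; rewrite /S /=.
rewrite (_ : _ @^-1` _ = [set x : 'rV[R]_n | a < x 0 i]); first exact: multiplier_halfspace.
by apply/seteqP; split=> x /=; rewrite in_itv/= andbT.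
Qed.

Import HBNNSimple.

(** The function 1 lies in the closure and indicators are multipliers; simple
    functions, then nonnegative functions, follow by dominated convergence. *)
Lemma approx_L2 f : L2 f -> approx f.
Proof.
have ge0 g : L2 g -> (forall x, 0 <= g x) -> approx g.
  move=> lg g0; have [mg _] := lg.
  have mG : measurable_fun setT (EFin \o g) by exact/measurable_EFinP.
  pose h := nnsfun_approx measurableT mG.
  have h_g k x : h k x <= g x.
    rewrite -lee_fin nnsfun_approxE; apply: (@le_approx _ _ _ setT (EFin \o g) k x) => // y _; rewrite lee_fin; exact: g0.
  apply: (@approx_cvg (fun k x => h k x) _ g).
  - move=> k; rewrite (_ : (fun x => h k x) = (fun x => \sum_(y \in range (h k)) y * \1_(h k @^-1` [set y]) x)).
      under eq_fun do rewrite fsbig_finite//=.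
      elim: (finmap.enum_fset _) => [|y s IH].
        under eq_fun do rewrite big_nil.
        by apply: (@approx_Pol 0); exact: Pol_cst.
      under eq_fun do rewrite big_cons.
      apply: approxD => //.
      have mB : measurable (h k @^-1` [set y]).
        by rewrite -[X in measurable X]setTI; apply: (measurable_funP (h k)).
      have [_ _ /(_ (cst y)) ah] := multiplier_indic mB.
      rewrite (_ : (fun x => y * _) = \1_(h k @^-1` [set y]) \* cst y).
        by apply: ah; apply: (@approx_Pol 0); exact: Pol_cst.
      by apply/funext => x /=; rewrite mulrC.
    by apply/funext => x; rewrite fimfunE.
  - move=> x.
    have := @cvg_nnsfun_approx _ _ _ _ measurableT _ mG (fun x _ => g0 x) x I.
    by move=> /fine_cvg.
  - by move=> k x; rewrite !ger0_norm.
  - exact: lg.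
move=> lf; have [mf _] := lf.
have -> : f = (fun x => Num.max (f x) 0) \+ (-1 \*o (fun x => Num.max (- f x) 0)).
  apply/funext => x /=; case: (leP (f x) 0) => fx.
    by rewrite max_l ?oppr_ge0// mulN1r opprK add0r.
  by rewrite max_r ?oppr_le0 ?ltW// mulr0 addr0.
apply: approxD.
  apply: ge0 => [|x]; last by rewrite le_max lexx orbT.
  apply: (L2_le _ _ lf); first exact: measurable_maxr.
  by move=> x; case: (leP (f x) 0) => fx; rewrite ?normr0.
have [_ _ ] := multiplier_cst (-1); apply.
apply: ge0 => [|x]; last by rewrite le_max lexx orbT.
apply: (L2_le _ _ lf); first by apply: measurable_maxr => //; exact: measurableT_comp.
by move=> x; case: (leP (- f x) 0) => fx; rewrite ?normr0 ?normrN.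
Qed.

End polynomial_density.

(** * Smooth functions with compact support *)

Section flat.
Context (R : realType).

(** The span of these functions is closed under differentiation, which makes them
    smooth; [flat 0] composed with 1 - |x|^2 / k provides the cut-off functions. *)
Definition flat (m : nat) (t : R) : R := if 0 < t then t^-1 ^+ m * expR (- t^-1) else 0.

Lemma pow_le_expR (m : nat) (s : R) : 0 <= s -> s ^+ m / m`!%:R <= expR s.
Proof.
move=> s0; apply: (@le_trans _ _ (exp_sum m.+1 s)).
  rewrite /exp_sum big_ord_recr/= lerDr; apply: sumr_ge0 => j _.
  by rewrite divr_ge0// exprn_ge0.
apply: (le_trans (ler_norm _)); apply: (le_trans (exp_sum_bound _ _)).
by rewrite ger0_norm.
Qed.

(** With s = 1 / t this is the comparison of s^m / m! with the exponential series. *)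
Lemma flat_bound m t : `|flat m t| <= m`!%:R.
Proof.
rewrite /flat; case: ifPn => t0; last by rewrite normr0.
have s0 : 0 <= t^-1 by rewrite invr_ge0 ltW.
rewrite ger0_norm; last by rewrite mulr_ge0 ?exprn_ge0// expR_ge0.
rewrite expRN ler_pdivrMr ?expR_gt0// mulrC -ler_pdivrMr ?pow_le_expR//.
Qed.

Lemma flatS m t : flat m t = t * flat m.+1 t.
Proof.
rewrite /flat; case: ifPn => t0; last by rewrite mulr0.
by rewrite exprS !mulrA divff ?mul1r// gt_eqF.
Qed.

(** At the origin, the difference quotient flat m h / h equals h * flat (m + 2) h,
    which is at most (m + 2)! |h|. *)
Lemma is_derive_flat m (t : R) :
  is_derive t 1 (flat m) (flat m.+2 t - m%:R * flat m.+1 t).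
Proof.
have [t0|t0|->] := ltrgtP t 0.
- have -> : flat m.+2 t - m%:R * flat m.+1 t = 0.
    by rewrite /flat ltNge (ltW t0)/= mulr0 subr0.
  apply: (@near_eq_is_derive _ _ _ (cst 0)).
  by apply: filterS (lt_nbhsl t0) => s s0; rewrite /flat ltNge (ltW s0).
- apply: (@near_eq_is_derive _ _ _ (fun s : R => s^-1 ^+ m * expR (- s^-1))).
    by apply: filterS (lt_nbhsr t0) => s s0; rewrite /flat s0.
  have tn0 : t != 0 by rewrite gt_eqF.
  have dV : is_derive t 1 (fun s : R => s^-1) (- t ^- 2).
    have dv : derivable (fun s : R => s^-1) t 1 by apply: (@derivableV _ _ (@id R)) => //; exact: derivable_id.
    apply: DeriveDef => //; rewrite (@deriveV _ _ (@id R) _ _ tn0 (@derivable_id _ _ t 1)).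
    by rewrite derive_id /GRing.scale/= mulr1.
  have dN := is_deriveN dV.
  have dE : is_derive t 1 (expR \o (fun s : R => - s^-1)) (expR (- t^-1) * t ^- 2).
    by have := @is_derive1_comp R expR (fun s => - s^-1) t _ _ (is_derive_expR _) dN; rewrite opprK.
  have dX := is_deriveX m dV.
  have dM := is_deriveM dX dE.
  have fE : (fun s : R => s^-1 ^+ m * expR (- s^-1)) =
      (fun s : R => s^-1) ^+ m * (expR \o (fun s : R => - s^-1)).
    by apply/funext => s; rewrite mulrfctE exprfctE.
  rewrite fE; apply: (is_derive_eq dM); rewrite exprfctE.
  rewrite /flat !t0 /GRing.scale/= /=; case: m {dX dM fE} => [|m] /=; rewrite ?fctE.
    by field.
  by rewrite !exprS; field.
- have -> : flat m.+2 0 - m%:R * flat m.+1 0 = 0 :> R by rewrite /flat ltxx mulr0 subr0.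
  have c0 : h^-1 *: ((flat m \o shift 0) (h *: 1) - flat m 0) @[h --> 0^'] --> (0 : R).
    apply/cvgrPdist_le => e e0; near=> h.
    have h0 : h != 0 by near: h; exact: nbhs_dnbhs_neq.
    rewrite /= addr0 /GRing.scale/= mulr1 {2}/flat ltxx subr0 sub0r normrN flatS flatS.
    rewrite /GRing.scale/= mulKf// normrM.
    apply: (@le_trans _ _ (`|h| * m.+2`!%:R)); first by rewrite ler_wpM2l// flat_bound.
    rewrite -ler_pdivlMr ?ltr0n ?fact_gt0//.
    near: h; apply: dnbhs0_le; by rewrite divr_gt0// ltr0n fact_gt0.
  apply: DeriveDef; first by apply/cvg_ex; exists 0; exact: c0.
  exact: (cvg_lim _ c0).
Unshelve. all: by end_near. Qed.

End flat.

Section partial_derivatives.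
Context (R : realType) (n : nat).
Implicit Types (f g p : 'rV[R]_n -> R).

Definition diffable f := forall x, differentiable f x.

Lemma diffableD f g : diffable f -> diffable g -> diffable (f \+ g).
Proof. by move=> df dg x; apply: differentiableD; [exact: df|exact: dg]. Qed.

Lemma diffableM f g : diffable f -> diffable g -> diffable (f \* g).
Proof. by move=> df dg x; apply: differentiableM; [exact: df|exact: dg]. Qed.

Lemma partialD i f g : diffable f -> diffable g ->
  partial i (f \+ g) = partial i f \+ partial i g.
Proof.
by move=> df dg; apply/funext => x; rewrite /partial deriveD//; exact: diff_derivable.
Qed.

Lemma partialM i f g : diffable f -> diffable g ->
  partial i (f \* g) = (f \* partial i g) \+ (g \* partial i f).
Proof.
by move=> df dg; apply/funext => x; rewrite /partial deriveM//; exact: diff_derivable.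
Qed.

Lemma partial_cst i c : partial i (cst c : 'rV[R]_n -> R) = cst 0.
Proof. by apply/funext => x; rewrite /partial derive_cst. Qed.

Lemma diffable_coord j : diffable (fun x : 'rV[R]_n => x 0 j).
Proof. by move=> x; exact: differentiable_coord. Qed.

Lemma partial_coord i j :
  partial i (fun x : 'rV[R]_n => x 0 j) = cst (j == i)%:R.
Proof.
apply/funext => x; rewrite /partial.
apply: (@cvg_lim _ _ _ (0^')) => //.
rewrite (_ : (fun h : R => _) = (fun h : R => h^-1 *: (h * (j == i)%:R))).
  apply/cvgrPdist_le => e e0; near=> h.
  have h0 : h != 0 by near: h; exact: nbhs_dnbhs_neq.
  by rewrite /GRing.scale/= mulKf// subrr normr0 ltW.
apply/funext => h; congr (_ *: _); rewrite /= !mxE eqxx/=.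
by rewrite [j == i]eq_sym addrK.
Unshelve. all: by end_near. Qed.

Lemma diffable_comp (phi phi' : R -> R) f : (forall t : R, is_derive t (1 : R) phi (phi' t)) ->
  diffable f -> diffable (phi \o f).
Proof.
move=> dphi df x; apply: differentiable_comp; first exact: df.
by apply/derivable1_diffP; have [] := dphi (f x).
Qed.

Lemma partial_comp i (phi phi' : R -> R) f : (forall t : R, is_derive t (1 : R) phi (phi' t)) ->
  diffable f -> partial i (phi \o f) = (phi' \o f) \* partial i f.
Proof.
move=> dphi df; apply/funext => x; rewrite /partial.
have [dp pE] := dphi (f x).
have dp' : differentiable phi (f x) by apply/derivable1_diffP.
rewrite deriveE; last exact: differentiable_comp.
rewrite diff_comp//= -(deriveE _ (df x)).
set y := 'D_(delta_mx 0 i) f x.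
have -> : 'd phi (f x) y = 'd phi (f x) (y *: (1 : R)) by rewrite /GRing.scale/= mulr1.
by rewrite linearZ/= -deriveE// pE /GRing.scale/= mulrC.
Qed.

Lemma diffable_sum (I : Type) (s : seq I) (F : I -> 'rV[R]_n -> R) :
  (forall j, diffable (F j)) -> diffable (fun x => \sum_(j <- s) F j x).
Proof.
move=> dF; elim: s => [|j s IH].
  rewrite (_ : (fun x => _) = cst 0); first by move=> x; exact: differentiable_cst.
  by apply/funext => x; rewrite big_nil.
rewrite (_ : (fun x => _) = F j \+ (fun x => \sum_(j <- s) F j x)).
  exact: diffableD.
by apply/funext => x; rewrite big_cons.
Qed.

Lemma partial_sum i (I : Type) (s : seq I) (F : I -> 'rV[R]_n -> R) :
  (forall j, diffable (F j)) ->
  partial i (fun x => \sum_(j <- s) F j x) = fun x => \sum_(j <- s) partial i (F j) x.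
Proof.
move=> dF; elim: s => [|j s IH].
  rewrite (_ : (fun x => _) = cst 0); last by apply/funext => x; rewrite big_nil.
  by rewrite partial_cst; apply/funext => x; rewrite big_nil.
rewrite (_ : (fun x => _) = F j \+ (fun x => \sum_(j <- s) F j x)); last first.
  by apply/funext => x; rewrite big_cons.
by rewrite partialD ?IH//; [apply/funext => x; rewrite big_cons|exact: diffable_sum].
Qed.

Let diff_sqr (j : 'I_n) : diffable (fun x : 'rV[R]_n => x 0 j * x 0 j).
Proof. by apply: diffableM; exact: diffable_coord. Qed.

Lemma diffable_sqnorm : diffable (@sqnorm R n).
Proof. exact: (diffable_sum (index_enum _) diff_sqr). Qed.

Lemma partial_sqnorm i : partial i (@sqnorm R n) = 2 \*o (fun x => x 0 i).
Proof.
rewrite (partial_sum i (index_enum _) diff_sqr); apply/funext => x.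
rewrite (bigD1 i)//= big1 ?addr0 => [|j ji].
  rewrite (partialM i (@diffable_coord i) (@diffable_coord i)) partial_coord.
  by rewrite /= eqxx mulr1 mulr_natl mulr2n.
rewrite (partialM i (@diffable_coord j) (@diffable_coord j)) partial_coord.
by rewrite /= (negbTE ji) mulr0 addr0.
Qed.

(** This family contains the test functions needed below and is closed under partial
    derivatives, so that its members are smooth without any computation of
    higher-order derivatives. *)
Inductive elementary (k : R) : ('rV[R]_n -> R) -> Prop :=
| elem_cst c : elementary k (cst c)
| elem_coord j : elementary k (fun x => x 0 j)
| elem_gauss : elementary k (@gaussian_pdf R n)
| elem_flat m : elementary k (fun x => flat m (1 - sqnorm x / k))
| elemD f g : elementary k f -> elementary k g -> elementary k (f \+ g)
| elemM f g : elementary k f -> elementary k g -> elementary k (f \* g).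

Let q_gauss : 'rV[R]_n -> R := (- 2^-1) \*o @sqnorm R n.

Lemma gaussian_pdf_comp :
  @gaussian_pdf R n = ((2 * pi) `^ (- (n%:R / 2))) \*o (expR \o q_gauss).
Proof.
by apply/funext => x; rewrite /gaussian_pdf /q_gauss/= mulNr [2^-1 * _]mulrC.
Qed.

Lemma diffableZ c f : diffable f -> diffable (c \*o f).
Proof.
by move=> df x; apply: (@differentiableM _ _ (cst c) f) => //; exact: differentiable_cst.
Qed.

Lemma partialZ i c f : diffable f -> partial i (c \*o f) = c \*o partial i f.
Proof.
move=> df; rewrite (partialM i (f := cst c)) ?partial_cst//.
  by apply/funext => x /=; rewrite mulr0 addr0.
Qed.

Lemma diffable_gaussian_pdf : diffable (@gaussian_pdf R n).
Proof.
rewrite gaussian_pdf_comp; apply: diffableZ; apply: (diffable_comp (@is_derive_expR R)).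
by apply: diffableZ; exact: diffable_sqnorm.
Qed.

Lemma partial_gaussian_pdf i :
  partial i (@gaussian_pdf R n) = fun x => - x 0 i * gaussian_pdf x.
Proof.
rewrite {1}gaussian_pdf_comp partialZ; last first.
  apply: (diffable_comp (@is_derive_expR R)).
  by apply: diffableZ; exact: diffable_sqnorm.
rewrite (partial_comp i (@is_derive_expR R)); last by apply: diffableZ; exact: diffable_sqnorm.
rewrite partialZ ?partial_sqnorm; last exact: diffable_sqnorm.
by apply/funext => x; rewrite gaussian_pdf_comp /=; field.
Qed.

Lemma diffable_flat_sqnorm k m : diffable (fun x : 'rV[R]_n => flat m (1 - sqnorm x / k)).
Proof.
apply: (diffable_comp (@is_derive_flat R m) (f := fun x => 1 - sqnorm x / k)) => x.
apply: differentiableB; first exact: differentiable_cst.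
by apply: differentiableM; [exact: diffable_sqnorm|exact: differentiable_cst].
Qed.

Lemma partial_flat_sqnorm i k m : partial i (fun x : 'rV[R]_n => flat m (1 - sqnorm x / k)) =
  fun x => (flat m.+2 (1 - sqnorm x / k) - m%:R * flat m.+1 (1 - sqnorm x / k)) *
    (- (2 / k) * x 0 i).
Proof.
have E : (fun x : 'rV[R]_n => 1 - sqnorm x / k) = cst 1 \+ ((- k^-1) \*o @sqnorm R n).
  by apply/funext => x /=; rewrite mulNr mulrC.
have d1 : diffable (cst 1 : 'rV[R]_n -> R) by move=> x; exact: differentiable_cst.
have d2 : diffable ((- k^-1) \*o @sqnorm R n) by apply: diffableZ; exact: diffable_sqnorm.
rewrite (partial_comp i (@is_derive_flat R m) (f := fun x => 1 - sqnorm x / k)); last first.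
  by rewrite E => x; apply: differentiableD; [exact: d1|exact: d2].
rewrite [in X in _ \* X]E (partialD _ d1 d2) partial_cst partialZ; last exact: diffable_sqnorm.
rewrite partial_sqnorm; apply/funext => x /=; rewrite add0r; congr (_ * _).
by rewrite mulrA; congr (_ * _); rewrite mulNr mulrC.
Qed.

Lemma elementary_partial k f : elementary k f ->
  diffable f /\ forall i, elementary k (partial i f).
Proof.
elim => {f} [c|j||m|f g _ [df pf] _ [dg pg]|f g ef [df pf] eg [dg pg]].
- split; first by move=> x; exact: differentiable_cst.
  by move=> i; rewrite partial_cst; exact: elem_cst.
- split; first exact: diffable_coord.
  by move=> i; rewrite partial_coord; exact: elem_cst.
- split; first exact: diffable_gaussian_pdf.
  move=> i; rewrite partial_gaussian_pdf.
  rewrite (_ : (fun x => _) = (cst (-1) \* (fun x : 'rV[R]_n => x 0 i)) \* @gaussian_pdf R n); last first.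
    by apply/funext => x /=; rewrite mulN1r.
  apply: elemM; last exact: elem_gauss.
  by apply: elemM; [exact: elem_cst|exact: elem_coord].
- split; first exact: diffable_flat_sqnorm.
  move=> i; rewrite partial_flat_sqnorm.
  rewrite (_ : (fun x => _) = ((fun x : 'rV[R]_n => flat m.+2 (1 - sqnorm x / k)) \+
     (cst (- m%:R) \* (fun x : 'rV[R]_n => flat m.+1 (1 - sqnorm x / k)))) \*
     (cst (- (2 / k)) \* (fun x : 'rV[R]_n => x 0 i))); last first.
    by apply/funext => x /=; rewrite mulNr.
  apply: elemM; last by apply: elemM; [exact: elem_cst|exact: elem_coord].
  apply: elemD; first exact: elem_flat.
  by apply: elemM; [exact: elem_cst|exact: elem_flat].
- split; first exact: diffableD.
  by move=> i; rewrite partialD//; apply: elemD; [exact: pf|exact: pg].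
- split; first exact: diffableM.
  move=> i; rewrite partialM//.
  by apply: elemD; apply: elemM.
Qed.

Lemma elementary_smooth k f : elementary k f -> smooth f.
Proof.
move=> ef s; have es : elementary k (foldr (@partial R n) f s).
  by elim: s => //= i s IH; have [_] := elementary_partial IH; apply.
have [ds _] := elementary_partial es; split.
  by move=> x; exact: differentiable_continuous.
by move=> i x; exact: diff_derivable.
Qed.

Lemma elementary_Pol k m p : Pol m p -> elementary k p.
Proof.
elim => {m p} [m c|m i f _ IH|m f g _ IHf _ IHg].
- exact: elem_cst.
- by apply: elemM => //; exact: elem_coord.
- exact: elemD.
Qed.

Lemma Pol_diffable m p : Pol m p -> diffable p.
Proof. by move=> /(elementary_Pol 1)/elementary_partial[]. Qed.

Lemma partial_mulX i j f : diffable f ->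
  partial i (mulX j f) = mulX j (partial i f) \+ ((j == i)%:R \*o f).
Proof.
move=> df; rewrite (partialM i (@diffable_coord j) df) partial_coord.
by apply/funext => x /=; rewrite [f x * _]mulrC.
Qed.

Lemma Pol_partial m i p : Pol m p -> Pol m.-1 (partial i p).
Proof.
elim => {m p} [m c|m j f pf IH|m f g pf IHf pg IHg].
- by rewrite partial_cst; exact: Pol_cst.
- rewrite partial_mulX; last exact: Pol_diffable pf.
  apply: PolD; last exact: PolZ.
  case: m pf IH => [|m] pf IH /=; last exact: Pol_mulX.
  (* In degree 0 the factor x_j would raise the degree, but here f is constant. *)
  move: pf IH; move E : 0%N => z pf IH.
  suff -> : partial i f = cst 0.
    rewrite (_ : mulX _ _ = cst 0); first exact: Pol_cst.
    by apply/funext => x; rewrite /mulX mulr0.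
  elim: pf E {IH} => {z f} [z c|//|z f g pf IHf pg IHg] E.
    by rewrite partial_cst.
  rewrite partialD ?IHf ?IHg//; [|exact: Pol_diffable pf|exact: Pol_diffable pg].
  by apply/funext => x /=; rewrite addr0.
- rewrite partialD; [exact: PolD|exact: Pol_diffable pf|exact: Pol_diffable pg].
Qed.

Lemma compact_box (K : R) : compact [set x : 'rV[R]_n | forall i, x 0 i \in `[- K, K]].
Proof.
have := @rV_compact R n (fun=> `[- K, K]%classic) (fun=> @segment_compact _ _ _).
exact.
Qed.

End partial_derivatives.

(** * Integration by parts for the weak gradient *)

Section weak_integration_by_parts.
Context (R : realType) (n : nat).
Local Notation gamma := (gaussian R n).
Local Notation lam := (lebesgue_rV R n).
Implicit Types (u p f : 'rV[R]_n -> R) (g : 'rV[R]_n -> 'rV[R]_n).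

Let cut (k : R) (m : nat) : 'rV[R]_n -> R := fun x => flat m (1 - sqnorm x / k).

Lemma measurable_cut k m : measurable_fun setT (cut k m).
Proof.
have mb : measurable_fun setT (flat m : R -> R).
  apply: continuous_measurable_fun => t; apply: differentiable_continuous.
  by apply/derivable1_diffP; have [] := is_derive_flat m t.
apply: (measurableT_comp mb); apply: measurable_funB => //.
by apply: measurable_funM => //; exact: measurable_sqnorm.
Qed.

Lemma cut_bound k m x : `|cut k m x| <= m`!%:R.
Proof. exact: flat_bound. Qed.

Lemma test_function_cut k m p : 0 < k -> Pol m p ->
  test_function (p \* (@gaussian_pdf R n \* cut k 0)).
Proof.
move=> k0 pp; split.
  apply: (@elementary_smooth _ _ k); apply: elemM; first exact: elementary_Pol pp.
  by apply: elemM; [exact: elem_gauss|exact: elem_flat].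
have cB := @compact_box R n (1 + k).
apply: (subclosed_compact _ cB); first exact: closed_closure.
have clB := compact_closed (@norm_hausdorff _ _) cB.
rewrite [X in _ `<=` X](closure_id _).1//.
apply: closureS => x /= fx0 i.
have sk : sqnorm x < k.
  rewrite ltNge; apply/negP => ks; move/eqP: fx0; apply.
  rewrite /cut /flat ifF ?mulr0//; apply/negbTE; rewrite -leNgt subr_le0.
  by rewrite ler_pdivlMr// mul1r.
have xk := le_lt_trans (sqr_le_sqnorm x i) sk.
rewrite -(real_normK (num_real (x 0 i))) in xk.
by rewrite in_itv/= -ler_norml; have := normr_ge0 (x 0 i); nra.
Qed.

(** The partial derivative of the test function, divided by the Gaussian density; the
    last term comes from the cut-off and tends to 0 as k tends to infinity. *)
Let cut_partial k i p := fun x : 'rV[R]_n =>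
  (partial i p x - x 0 i * p x) * cut k 0 x + p x * (cut k 2 x * (- (2 / k) * x 0 i)).

Lemma partial_test_function k m i p : Pol m p ->
  partial i (p \* (@gaussian_pdf R n \* cut k 0)) = fun x => cut_partial k i p x * gaussian_pdf x.
Proof.
move=> pp; have dp := Pol_diffable pp; have dG := @diffable_gaussian_pdf R n.
have dc := @diffable_flat_sqnorm R n k 0.
rewrite (partialM i dp (diffableM dG dc)) (partialM i dG dc) partial_gaussian_pdf partial_flat_sqnorm.
by apply/funext => x; rewrite /cut_partial /cut /=; ring.
Qed.

Lemma measurable_Pol m p : Pol m p -> measurable_fun setT p.
Proof. by move=> /Pol_moderate[]. Qed.

Lemma measurable_partial m i p : Pol m p -> measurable_fun setT (partial i p).
Proof. by move=> /(Pol_partial i); exact: measurable_Pol. Qed.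

(** The density of the Gaussian measure is a factor of the test function, which turns
    the Lebesgue integrals of the definition into Gaussian ones. *)
Lemma weak_ibp_cut u g k m p i : measurable_fun setT u ->
  measurable_fun setT (fun x => g x 0 i) -> weak_gradient u g -> 0 < k -> Pol m p ->
  ip u (cut_partial k i p) = - ip (fun x => g x 0 i) (p \* cut k 0).
Proof.
move=> mu mg ug k0 pp; have := ug _ (test_function_cut k0 pp) i.
have mp := measurable_Pol pp; have mpp := measurable_partial i pp.
have mc0 := measurable_cut k 0; have mc2 := measurable_cut k 2.
have mcp : measurable_fun setT (cut_partial k i p).
  apply: measurable_funD; apply: measurable_funM => //.
    apply: measurable_funB => //; apply: measurable_funM => //; exact: measurable_coord.
  apply: measurable_funM => //; apply: measurable_funM => //; exact: measurable_coord.
rewrite (partial_test_function k i pp).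
rewrite (eq_integral (fun x => ((u x * cut_partial k i p x) * gaussian_pdf x)%:E)); last first.
  by move=> x _; rewrite mulrA.
rewrite -integral_gaussian; last exact: measurable_funM.
rewrite [in RHS](eq_integral (fun x => ((g x 0 i * (p x * cut k 0 x)) * gaussian_pdf x)%:E)); last first.
  by move=> x _ /=; congr (_%:E); ring.
rewrite -[in RHS]integral_gaussian; last first.
  by apply: measurable_funM => //; exact: measurable_funM.
by move=> /(congr1 fine); rewrite fineN.
Qed.

(** The weak formulation allows compactly supported test functions only; the cut-off is
    removed by dominated convergence. *)
Lemma weak_ibp u g m p i : L2 u -> L2 (fun x => g x 0 i) -> weak_gradient u g ->
  Pol m p -> ip (fun x => g x 0 i) p = ip u (mulX i p \- partial i p).
Proof.
move=> lu lg ug pp; have [mu _] := lu; have [mg _] := lg.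
have mp := measurable_Pol pp; have mpp := measurable_partial i pp.
have lp := Pol_L2 pp; have lpp := Pol_L2 (Pol_partial i pp).
have lxp := Pol_L2 (Pol_mulX i pp).
have cc m' x : cut k.+1%:R m' x @[k --> \oo] --> (flat m' 1 : R).
  have dflat : {for (1 : R), continuous (flat m')}.
    apply: differentiable_continuous.
    by apply/derivable1_diffP; have [] := is_derive_flat m' (1 : R).
  rewrite /cut; apply: (@continuous_cvg _ _ _ _ _ (fun k => 1 - sqnorm x / k.+1%:R) _ _ dflat).
  rewrite -[X in _ --> X]subr0 -[X in _ - X](mulr0 (sqnorm x)).
  apply: cvgB; first exact: cvg_cst.
  by apply: cvgM; [exact: cvg_cst|exact: cvg_harmonic].
have mcp k : measurable_fun setT (cut_partial k i p).
  apply: measurable_funD; apply: measurable_funM => //.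
  - apply: measurable_funB => //; apply: measurable_funM => //; exact: measurable_coord.
  - exact: measurable_cut.
  apply: measurable_funM; first exact: measurable_cut.
  by apply: measurable_funM => //; exact: measurable_coord.
have c1 : ip u (cut_partial k.+1%:R i p) @[k --> \oo] -->
    ip u (flat 0 (1 : R) \*o (partial i p \- mulX i p)).
  (* The factor 5 is 1 for the term with [cut k 0], bounded by 0!, plus 4 for the
     other term: [cut k 2] is bounded by 2! and 2 / k by 2. *)
  pose h := fun x => `|u x| * (`|partial i p x| + 5 * `|mulX i p x|).
  apply: (@Rintegral_dominated_cvg _ _ _ gamma _ _ h).
  - by move=> k; apply: measurable_funM.
  - apply: measurable_funM => //; apply: measurable_funM => //; apply: measurable_funB => //.
    by apply: measurable_funM => //; exact: measurable_coord.
  - move=> x; apply: cvgM; first exact: cvg_cst.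
    rewrite /cut_partial /= -[X in _ --> X]addr0; apply: cvgD.
      by rewrite [X in _ --> X]mulrC; apply: cvgM; [exact: cvg_cst|exact: cc].
    rewrite -[X in _ --> X](mulr0 (p x)); apply: cvgM; first exact: cvg_cst.
    rewrite -[X in _ --> X](mulr0 (flat 2 (1 : R))); apply: cvgM; first exact: cc.
    rewrite -[X in _ --> X](mul0r (x 0 i)); apply: cvgM; last exact: cvg_cst.
    rewrite -oppr0; apply: cvgN; rewrite -[X in _ --> X](mulr0 2).
    by apply: cvgM; [exact: cvg_cst|exact: cvg_harmonic].
  - apply: L2_integrableM.
      by apply: (L2_le _ _ lu) => [|x]; [exact: measurableT_comp|rewrite normr_id].
    apply: L2D.
      by apply: (L2_le _ _ lpp) => [|x]; [exact: measurableT_comp|rewrite normr_id].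
    apply: (L2Z 5); apply: (L2_le _ _ lxp) => [|x]; last by rewrite normr_id.
    apply: measurableT_comp => //; apply: measurable_funM => //; exact: measurable_coord.
  - move=> k x; rewrite /h normrM; apply: ler_wpM2l => //.
    apply: (le_trans (ler_normD _ _)).
    have b0 := cut_bound k.+1%:R 0 x; have b2 := cut_bound k.+1%:R 2 x.
    have i1 : `|(partial i p x - x 0 i * p x) * cut k.+1%:R 0 x| <=
        `|partial i p x| + `|mulX i p x|.
      rewrite normrM; apply: (@le_trans _ _ (`|partial i p x - x 0 i * p x| * 1)).
        exact: ler_wpM2l.
      by rewrite mulr1; exact: ler_normB.
    have i2 : `|p x * (cut k.+1%:R 2 x * (- (2 / k.+1%:R) * x 0 i))| <= 4 * `|mulX i p x|.
      rewrite (_ : _ * _ = (cut k.+1%:R 2 x * - (2 / k.+1%:R)) * mulX i p x); last first.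
        by rewrite /mulX; ring.
      rewrite normrM ler_wpM2r// normrM (_ : 4 = 2 * 2); last by rewrite -natrM.
      apply: ler_pM => //; rewrite normrN ger0_norm// ler_pdivrMr// ler_peMr//.
      by rewrite ler1n.
    by move: i1 i2; lra.
have c2 : - ip (fun x => g x 0 i) (p \* cut k.+1%:R 0) @[k --> \oo] -->
    - ip (fun x => g x 0 i) (flat 0 (1 : R) \*o p).
  apply: cvgN; apply: (@Rintegral_dominated_cvg _ _ _ gamma _ _ (fun x => `|g x 0 i| * `|p x|)).
  - move=> k; apply: measurable_funM => //; apply: measurable_funM => //.
    exact: measurable_cut.
  - by apply: measurable_funM => //; exact: measurable_funM.
  - move=> x; apply: cvgM; first exact: cvg_cst.
    by rewrite /= [X in _ --> X]mulrC; apply: cvgM; [exact: cvg_cst|exact: cc].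
  - apply: L2_integrableM.
      by apply: (L2_le _ _ lg) => [|x]; [exact: measurableT_comp|rewrite normr_id].
    by apply: (L2_le _ _ lp) => [|x]; [exact: measurableT_comp|rewrite normr_id].
  - move=> k x; rewrite normrM; apply: ler_wpM2l => //=; rewrite normrM ler_piMr//.
    exact: cut_bound.
have E : ip u (flat 0 (1 : R) \*o (partial i p \- mulX i p)) =
    - ip (fun x => g x 0 i) (flat 0 (1 : R) \*o p).
  rewrite -(cvg_lim _ c1)// -(cvg_lim _ c2)//; congr (lim (_ @ \oo)).
  by apply/funext => k; rewrite (weak_ibp_cut mu mg ug _ pp).
(* The cut-off functions tend to exp(-1) instead of 1; this common factor cancels. *)
have b1 : flat 0 (1 : R) != 0.
  by rewrite /flat ltr01 expr0 mul1r gt_eqF// expR_gt0.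
move: E; rewrite !ipZr//; last exact: L2B.
rewrite -mulrN => /(mulfI b1) /(congr1 -%R); rewrite opprK => <-.
by rewrite !ipBr// opprB.
Qed.

End weak_integration_by_parts.

(** * Integrals of partial derivatives *)

Section row_topology.
Context (R : realType).

Lemma cvg_rV n (T : Type) (F : set_system T) {FF : Filter F} (f : T -> 'rV[R]_n) (l : 'rV[R]_n) :
  (forall j, f x 0 j @[x --> F] --> l 0 j) -> f @ F --> l.
Proof.
move=> fl; apply/cvg_ballP => e e0.
have : \forall x \near F, forall j, ball (l 0 j) e (f x 0 j).
  by apply: filter_forall => j; move/cvg_ballP: (fl j); apply.
by apply: filterS => x h; split => // i j; rewrite ord1; exact: h.
Qed.

Lemma continuous_rV_cons_l n (y : 'rV[R]_n) : continuous (fun t => rV_cons (t, y)).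
Proof.
move=> t; apply: cvg_rV => j; case: (unliftP ord0 j) => [k ->|->].
  by under eq_fun do rewrite rV_consS; rewrite rV_consS; exact: cvg_cst.
by under eq_fun do rewrite rV_cons0; rewrite rV_cons0; exact: cvg_id.
Qed.

Lemma continuous_rV_cons_r n (t : R) : continuous (fun y : 'rV[R]_n => rV_cons (t, y)).
Proof.
move=> y; apply: (@cvg_rV _ _ (nbhs y) _ (fun y => rV_cons (t, y))) => j; case: (unliftP ord0 j) => [k ->|->].
  by under eq_fun do rewrite rV_consS; rewrite rV_consS; exact: coord_continuous.
by under eq_fun do rewrite rV_cons0; rewrite rV_cons0; exact: cvg_cst.
Qed.

(** A continuous function is the limit of its compositions with the roundings of the
    coordinates, which take countably many values. *)
Lemma continuous_measurable_rV n (f : 'rV[R]_n -> R) : continuous f -> measurable_fun setT f.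
Proof.
move=> cf.
pose z k (x : 'rV[R]_n) : 'rV[int]_n := \row_j Num.floor (k.+1%:R * x 0 j).
pose r k (v : 'rV[int]_n) : 'rV[R]_n := \row_j ((v 0 j)%:~R / k.+1%:R).
apply: (@measurable_fun_cvg _ _ _ _ (fun k x => f (r k (z k x)))).
  move=> k _ Y mY; rewrite setTI.
  rewrite (_ : _ @^-1` _ = \bigcup_(v in setT) (if f (r k v) \in Y then z k @^-1` [set v] else set0)); last first.
    apply/seteqP; split=> x /=.
      by move=> Yx; exists (z k x) => //; rewrite mem_set.
    by move=> [v _]; case: ifPn => // /set_mem Yv /= ->.
  apply: countable_bigcupT_measurable => [|v]; first exact: countableP.
  case: ifPn => // _.
  rewrite (_ : _ @^-1` _ = \bigcap_(j in setT) ((fun x : 'rV[R]_n => x 0 j) @^-1`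
     ([set t | (v 0 j)%:~R / k.+1%:R <= t < (v 0 j + 1)%:~R / k.+1%:R]))); last first.
    apply/seteqP; split=> x /=.
      move=> <- j _ /=; rewrite mxE ler_pdivrMr// ltr_pdivlMr// mulrC.
      exact: floor_itv.
    move=> h; apply/rowP => j; rewrite mxE; apply/eqP; rewrite floor_eq.
    by have := h j I; rewrite /= ler_pdivrMr// ltr_pdivlMr// mulrC.
  apply: fin_bigcap_measurable; first exact: finite_finset.
  move=> j _.
  rewrite -[X in measurable X]setTI; apply: measurable_coord => //.
  rewrite (_ : [set t | _] = `[(v 0 j)%:~R / k.+1%:R, (v 0 j + 1)%:~R / k.+1%:R[%classic); first exact: measurable_itv.
  by apply/seteqP; split => t /=; rewrite in_itv.
move=> x _; apply: continuous_cvg; first exact: cf.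
apply: cvg_rV => j; rewrite /r /z.
apply: (@squeeze_cvgr _ _ _ _ (fun k => x 0 j - harmonic k) (cst (x 0 j))).
- apply: nearW => k; rewrite !mxE /harmonic/=.
  have /andP[h1 h2] := floor_itv (k.+1%:R * x 0 j).
  have k0 : 0 < k.+1%:R :> R by [].
  apply/andP; split.
    by rewrite ler_pdivlMr// mulrBl mulVf ?gt_eqF// lerBlDr mulrC ltW// -[1]/(1%:~R) -intrD.
  by rewrite ler_pdivrMr// [leRHS]mulrC.
- by rewrite -[X in _ --> X]subr0; apply: cvgB; [exact: cvg_cst|exact: cvg_harmonic].
- exact: cvg_cst.
Qed.

End row_topology.

Section divergence.
Context (R : realType).
Local Notation mu := (@lebesgue_measure R).

Let shiftE n (h : R) (i k : 'I_n) (v : 'rV[R]_n) :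
  (h *: delta_mx 0 i + v) 0 k = h * (k == i)%:R + v 0 k.
Proof. by rewrite !mxE. Qed.

Lemma rV_cons_shift n (h t : R) (y : 'rV[R]_n) (j : 'I_n) :
  h *: delta_mx 0 (lift ord0 j) + rV_cons (t, y) = rV_cons (t, h *: delta_mx 0 j + y).
Proof.
apply/rowP => k; rewrite shiftE; case: (unliftP ord0 k) => [i ->|->].
  by rewrite !rV_consS shiftE (inj_eq lift_inj).
by rewrite !rV_cons0 mulr0 add0r.
Qed.

Lemma rV_cons_shift0 n (h t : R) (y : 'rV[R]_n) :
  h *: delta_mx 0 ord0 + rV_cons (t, y) = rV_cons (h + t, y).
Proof.
apply/rowP => k; rewrite shiftE; case: (unliftP ord0 k) => [i ->|->].
  by rewrite !rV_consS mulr0 add0r.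
by rewrite !rV_cons0 eqxx mulr1.
Qed.

Lemma is_derive_rV_cons n (f : 'rV[R]_n.+1 -> R) t y j df :
  is_derive (rV_cons (t, y)) (delta_mx 0 (lift ord0 j)) f df ->
  is_derive y (delta_mx 0 j) (fun y => f (rV_cons (t, y))) df.
Proof.
move=> [df1 df2].
have E : (fun h => h^-1 *: (((fun y => f (rV_cons (t, y))) \o shift y) (h *: delta_mx 0 j)
      - f (rV_cons (t, y)))) =
   (fun h => h^-1 *: ((f \o shift (rV_cons (t, y))) (h *: delta_mx 0 (lift ord0 j)) - f (rV_cons (t, y)))).
  by apply/funext => h /=; rewrite rV_cons_shift.
by apply: DeriveDef; rewrite ?/derivable ?/derive E.
Qed.

Lemma is_derive_rV_cons0 n (f : 'rV[R]_n.+1 -> R) (t : R) y df :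
  is_derive (rV_cons (t, y)) (delta_mx 0 ord0) f df ->
  is_derive t (1 : R) (fun t => f (rV_cons (t, y))) df.
Proof.
move=> [df1 df2].
have E : (fun h => h^-1 *: (((fun t => f (rV_cons (t, y))) \o shift t) (h *: (1 : R))
      - f (rV_cons (t, y)))) =
   (fun h => h^-1 *: ((f \o shift (rV_cons (t, y))) (h *: delta_mx 0 ord0) - f (rV_cons (t, y)))).
  by apply/funext => h /=; rewrite rV_cons_shift0 /GRing.scale/= mulr1.
by apply: DeriveDef; rewrite ?/derivable ?/derive E.
Qed.

Definition outside_box n (K : R) (x : 'rV[R]_n) := exists j, K < `|x 0 j|.

Lemma bounded_compact_support n (K : R) (f : 'rV[R]_n -> R) : 0 <= K -> continuous f ->
  (forall x, outside_box K x -> f x = 0) -> exists M, forall x, `|f x| <= M.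
Proof.
move=> K0 cf f0.
pose B := [set x : 'rV[R]_n | forall i, x 0 i \in `[- K, K]].
have B0 : B !=set0 by exists 0 => i; rewrite mxE in_itv/= oppr_le0 K0.
have cnf : {within B, continuous (fun x => `|f x|)}.
  apply: continuous_subspaceT => x; by apply: (@continuous_comp _ _ _ f Num.norm); [exact: cf|exact: norm_continuous].
have [c _ cmax] := EVT_max_rV B0 (@compact_box R n K) cnf.
exists `|f c| => x; have [xB|] := pselect (B x).
  by apply: cmax; rewrite inE.
move=> nB; rewrite f0 ?normr0//; apply: contrapT => nO; apply: nB => i.
rewrite in_itv/= -ler_norml leNgt; apply/negP => Ki; apply: nO; by exists i.
Qed.

(** On the support the function is bounded, and there exp(- |x|^2) is bounded below,
    so that a multiple of this integrable function dominates. *)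
Lemma integrable_compact_support n (K : R) (f : 'rV[R]_n -> R) : 0 <= K -> continuous f ->
  (forall x, outside_box K x -> f x = 0) -> (lebesgue_rV R n).-integrable setT (EFin \o f).
Proof.
move=> K0 cf f0; have [M fM] := bounded_compact_support K0 cf f0.
pose C := M * expR (n%:R * K ^+ 2).
apply: (@le_integrable _ _ _ _ _ _ _ (fun x => C%:E * (expR (- (1 * sqnorm x)))%:E)%E) => //.
- by apply/measurable_EFinP; exact: continuous_measurable_rV.
- move=> x _; rewrite -EFinM !abse_EFin lee_fin; apply: le_trans (ler_norm _).
  have M0 : 0 <= M by exact: le_trans (fM x).
  have [Ox|nO] := pselect (outside_box K x).
    by rewrite f0// normr0 !mulr_ge0// expR_ge0.
  apply: (le_trans (fM x)); rewrite /C -mulrA ler_peMr// -expRD mul1r.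
  rewrite -[leLHS]expR0 ler_expR subr_ge0 /sqnorm /dotrV.
  apply: (@le_trans _ _ (\sum_(i < n) K ^+ 2)); last first.
    by rewrite sumr_const card_ord mulr_natl.
  apply: ler_sum => i _; rewrite -expr2 -(real_normK (num_real (x 0 i))).
  rewrite lerXn2r ?nnegrE// leNgt; apply/negP => Ki; apply: nO; by exists i.
- by apply: integrableZl => //; exact: integrable_expR_sqnorm.
Qed.

(** The integral of a partial derivative with compact support vanishes: by Fubini this
    reduces to the fundamental theorem of calculus on a line. *)
Lemma integral_partial_eq0 n (i : 'I_n) (K : R) (f f' : 'rV[R]_n -> R) : 0 <= K ->
  continuous f' -> (forall x, is_derive x (delta_mx 0 i) f (f' x)) ->
  (forall x, outside_box K x -> f x = 0 /\ f' x = 0) ->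
  (\int[lebesgue_rV R n]_x (f' x)%:E = 0)%E.
Proof.
move=> K0; elim: n i f f' => [[]//|n IH] i f f' cf' ff' f0.
have f'i := integrable_compact_support K0 cf' (fun x Ox => (f0 x Ox).2).
case: (unliftP ord0 i) ff' => [j ->|->] ff'.
  rewrite integral_lebesgue_rVS1//.
  have E t : (\int[lebesgue_rV R n]_y (f' (rV_cons (t, y)))%:E = 0)%E.
    apply: (IH j (fun y => f (rV_cons (t, y))) (fun y => f' (rV_cons (t, y)))).
    - by move=> y; apply: continuous_comp; [exact: continuous_rV_cons_r|exact: cf'].
    - by move=> y; apply: is_derive_rV_cons; exact: ff'.
    - by move=> y [k Kk]; apply: f0; exists (lift ord0 k); rewrite rV_consS.
  by rewrite /=; under eq_integral do rewrite E; rewrite integral0.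
rewrite integral_lebesgue_rVS2//.
have E y : (\int[mu]_t (f' (rV_cons (t, y)))%:E = 0)%E.
  pose h t := f' (rV_cons (t, y)); pose H t := f (rV_cons (t, y)).
  have ch : continuous h.
    by move=> t; apply: continuous_comp; [exact: continuous_rV_cons_l|exact: cf'].
  have dH t : is_derive t (1 : R) H (h t) by apply: is_derive_rV_cons0; exact: ff'.
  have out t : K < `|t| -> H t = 0 /\ h t = 0.
    by move=> Kt; apply: f0; exists ord0; rewrite rV_cons0.
  have cH : continuous H.
    by move=> t; apply: differentiable_continuous; apply/derivable1_diffP; have [] := dH t.
  (* The endpoints lie strictly outside of the support, so that H vanishes at both. *)
  have ab : - (K + 1) < K + 1 by lra.
  rewrite (_ : (\int[mu]_t _)%E = (\int[mu]_(t in `[(- (K + 1))%R, (K + 1)%R]) (h t)%:E)%E); last first.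
    rewrite [RHS]integral_mkcond; apply: eq_integral => t _; rewrite patchE.
    case: ifPn => // /negP nt; rewrite -/(h t) (out t _).2//.
    rewrite ltNge; apply/negP => tK; apply: nt; rewrite inE/= in_itv/= -ler_norml.
    by apply: (le_trans tK); rewrite lerDl.
  rewrite (continuous_FTC2 ab (F := H)).
  - have HK : K < `|K + 1| by rewrite ger0_norm ?addr_ge0// ltrDl.
    by rewrite (out (K + 1) _).1// (out (- (K + 1)) _).1 ?normrN// subee.
  - exact: continuous_subspaceT.
  - split; first by move=> t _; have [] := dH t.
      by apply: cvg_at_right_filter; exact: cH.
    by apply: cvg_at_left_filter; exact: cH.
  - by move=> t _; rewrite derive1E; have [] := dH t.
by rewrite /=; under eq_integral do rewrite E; rewrite integral0.
Qed.

End divergence.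

(** * Polynomials in the Sobolev space *)

Section classical_gradient.
Context (R : realType) (n : nat).
Local Notation gamma := (gaussian R n).
Local Notation lam := (lebesgue_rV R n).
Implicit Types (u v p q f phi : 'rV[R]_n -> R) (g h : 'rV[R]_n -> 'rV[R]_n).

Lemma coord_norm_le (x : 'rV[R]_n) j : `|x 0 j| <= `|x|.
Proof.
rewrite [leRHS]mx_normrE; apply: (@le_bigmax _ _ _ 0 (fun i : 'I_1 * 'I_n => `|x i.1 i.2|) (0, j)).
Qed.

(** The box is closed with open complement, where phi vanishes identically; hence so
    do its partial derivatives there. *)
Lemma test_function_box phi : test_function phi ->
  exists2 K : R, 0 <= K & forall x, outside_box K x -> phi x = 0 /\ forall i, partial i phi x = 0.
Proof.
move=> [_ /compact_bounded [M [_ phiM]]].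
pose K := `|M| + 1; have K0 : 0 <= K by rewrite addr_ge0.
have MK : M < K by rewrite ltr_pwDr// ler_norm.
have phi0 x : outside_box K x -> phi x = 0.
  move=> [j Kj]; apply/eqP/negP => /negP nz.
  have /= xK := phiM K MK x (@subset_closure _ [set x | phi x != 0] x nz).
  move: Kj; rewrite ltNge; apply/negP; rewrite negbK; apply: le_trans xK.
  exact: coord_norm_le.
exists K => // x Ox; split; first exact: phi0.
move=> i; have [j Kj] := Ox.
have near0 : \near x, cst 0 x = phi x.
  have cj : {for x, continuous (fun y : 'rV[R]_n => `|y 0 j|)}.
    apply: (@continuous_comp _ _ _ (fun y : 'rV[R]_n => y 0 j) Num.norm).
      exact: coord_continuous.
    exact: norm_continuous.
  have near_j : \forall y \near x, K < `|(y : 'rV[R]_n) 0 j| by exact: (cj _ (lt_nbhsr Kj)).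
  apply: filterS near_j => y Kyj.
  by rewrite phi0//; exists j.
by rewrite /partial -(near_eq_derive _ near0) derive_cst.
Qed.

Lemma test_function_continuous phi : test_function phi -> continuous phi.
Proof. by move=> [/(_ [::]) []]. Qed.

Lemma test_function_partial_continuous phi i : test_function phi -> continuous (partial i phi).
Proof. by move=> [/(_ [:: i]) []]. Qed.

Lemma test_function_derivable phi i x : test_function phi -> derivable phi x (delta_mx 0 i).
Proof. by move=> [/(_ [::]) [_ dphi] _]; exact: dphi. Qed.

Lemma Pol_continuous m p : Pol m p -> continuous p.
Proof. by move=> pp x; apply: differentiable_continuous; exact: (Pol_diffable pp x). Qed.

(** The integral of the partial derivative of p phi vanishes; the product rule
    separates the two terms of the weak formulation. *)
Lemma weak_gradient_Pol m p : Pol m p -> weak_gradient p (fun x => \row_i partial i p x).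
Proof.
move=> pp phi tphi i; have [K K0 phi0] := test_function_box tphi.
have cp := Pol_continuous pp; have cpp := Pol_continuous (Pol_partial i pp).
have cphi := test_function_continuous tphi.
have cpphi := test_function_partial_continuous (i := i) tphi.
have c1 : continuous (fun x => p x * partial i phi x) by move=> x; apply: (@continuousM _ _ p (partial i phi)); [exact: cp|exact: cpphi].
have c2 : continuous (fun x => partial i p x * phi x) by move=> x; apply: (@continuousM _ _ (partial i p) phi); [exact: cpp|exact: cphi].
have i1 : lam.-integrable setT (EFin \o (fun x => p x * partial i phi x)).
  by apply: (integrable_compact_support K0) => // x /phi0[_ ->]; rewrite mulr0.
have i2 : lam.-integrable setT (EFin \o (fun x => partial i p x * phi x)).
  by apply: (integrable_compact_support K0) => // x /phi0[-> _]; rewrite mulr0.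
under [in RHS]eq_integral do rewrite mxE.
have s0 : (\int[lam]_x (p x * partial i phi x + partial i p x * phi x)%:E = 0)%E.
  apply: (@integral_partial_eq0 _ _ i K (p \* phi)) => //.
  - by move=> x; apply: (@continuousD _ _ _ (fun x => p x * partial i phi x)
      (fun x => partial i p x * phi x)); [exact: c1|exact: c2].
  - move=> x; have dp : derivable p x (delta_mx 0 i) by apply: diff_derivable; exact: (Pol_diffable pp x).
    have dphi : derivable phi x (delta_mx 0 i) by exact: test_function_derivable.
    have dd := is_deriveM (derivableP dp) (derivableP dphi).
    by apply: (is_derive_eq dd); rewrite /GRing.scale/= /partial; congr (_ + _); rewrite mulrC.
  - by move=> x /phi0[/= -> ->]; rewrite !mulr0 addr0.
move: s0; rewrite (_ : (\int[lam]_x _)%E =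
  (\int[lam]_x ((p x * partial i phi x)%:E + (partial i p x * phi x)%:E))%E)// integralD//.
have f1 := integrable_fin_num measurableT i1; have f2 := integrable_fin_num measurableT i2.
rewrite -(fineK f1) -(fineK f2) -EFinD -EFinN => -[] /eqP.
by rewrite addr_eq0 => /eqP ->.
Qed.

(** Dividing by the density, which is bounded below on the support, turns the
    Lebesgue integral into a Gaussian inner product. *)
Lemma integrable_L2_compact_support u (K : R) phi : L2 u -> 0 <= K -> continuous phi ->
  (forall x, outside_box K x -> phi x = 0) ->
  lam.-integrable setT (fun x => (u x * phi x)%:E).
Proof.
move=> lu K0 cphi phi0; pose w x := phi x / gaussian_pdf x.
have cw : continuous w.
  move=> x; apply: (@continuousM _ _ phi (fun x => (gaussian_pdf x)^-1)); first exact: cphi.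
  apply: continuousV; first by rewrite gt_eqF// gaussian_pdf_gt0.
  by apply: differentiable_continuous; exact: (@diffable_gaussian_pdf R n x).
have w0 x : outside_box K x -> w x = 0 by move=> /phi0; rewrite /w => ->; rewrite mul0r.
have [M wM] := bounded_compact_support K0 cw w0.
have mw := continuous_measurable_rV cw.
have lw : L2 w.
  have := L2_bounded mw wM (L2_moderate (moderate_cst n (1 : R))).
  by rewrite (_ : w \* cst 1 = w)//; apply/funext => x /=; rewrite mulr1.
have := L2_integrableM lu lw; move/integrable_gaussian.
have -> : (fun x => (u x * w x * gaussian_pdf x)%:E) = (fun x => (u x * phi x)%:E).
  apply/funext => x; rewrite /w -mulrA divfK// gt_eqF//; exact: gaussian_pdf_gt0.
by apply; have [mu _] := lu; exact: measurable_funM.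
Qed.

Lemma weak_gradientB u v g h : L2 u -> L2 v -> (forall i, L2 (fun x => g x 0 i)) ->
  (forall i, L2 (fun x => h x 0 i)) -> weak_gradient u g -> weak_gradient v h ->
  weak_gradient (fun x => u x - v x) (fun x => g x - h x).
Proof.
move=> lu lv lg lh wu wv phi tphi i; have [K K0 phi0] := test_function_box tphi.
have cphi := test_function_continuous tphi.
have cpphi := test_function_partial_continuous (i := i) tphi.
have phi0' x : outside_box K x -> phi x = 0 by case/phi0.
have pphi0 x : outside_box K x -> partial i phi x = 0 by case/phi0 => _; apply.
under eq_integral do rewrite mulrBl EFinB.
rewrite integralB//; [|exact: integrable_L2_compact_support K0 cpphi pphi0..].
rewrite (wu _ tphi) (wv _ tphi).
under [in RHS]eq_integral do rewrite !mxE mulrBl EFinB.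
have i1 := integrable_L2_compact_support (lg i) K0 cphi phi0'.
have i2 := integrable_L2_compact_support (lh i) K0 cphi phi0'.
rewrite integralB//.
by rewrite fin_num_oppeB ?integrable_fin_num// oppeK.
Qed.

Lemma L2_row_partial m p i : Pol m p -> L2 (fun x => (\row_j partial j p x) 0 i).
Proof.
by move=> pp; under eq_fun do rewrite mxE; exact: Pol_L2 (Pol_partial i pp).
Qed.

Lemma L2_weak_gradientP u g : L2_weak_gradient u g <->
  weak_gradient u g /\ forall i, L2 (fun x => g x 0 i).
Proof. by split=> -[? h]; split=> // i; apply/L2P; exact: h. Qed.

Lemma W12P u : W12 R n u -> [/\ L2 u, weak_gradient u (grad u) & forall i, L2 (fun x => grad u x 0 i)].
Proof.
move=> [/L2P lu [g gu]]; have := xgetPex (cst 0) (ex_intro _ g gu).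
by rewrite -/(grad u) => /L2_weak_gradientP[].
Qed.

Lemma W12_Pol m p : Pol m p -> W12 R n p.
Proof.
move=> pp; split; first by apply/L2P; exact: Pol_L2 pp.
exists (fun x => \row_i partial i p x); apply/L2_weak_gradientP; split.
  exact: weak_gradient_Pol pp.
by move=> i; exact: L2_row_partial pp.
Qed.

Lemma W12_subPol m u p : W12 R n u -> Pol m p -> W12 R n (fun x => u x - p x).
Proof.
move=> /W12P[lu wu lgu] pp; split; first by apply/L2P/L2B => //; exact: Pol_L2 pp.
exists (fun x => grad u x - \row_i partial i p x); apply/L2_weak_gradientP; split.
  apply: weak_gradientB => //; first exact: Pol_L2 pp.
    by move=> i; exact: L2_row_partial pp.
  exact: weak_gradient_Pol pp.
move=> i; rewrite (_ : (fun x => _) =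
  (fun x => grad u x 0 i) \- (fun x => (\row_j partial j p x) 0 i)).
  exact: L2B (lgu i) (L2_row_partial i pp).
by apply/funext => x; rewrite /= !mxE.
Qed.

(** The adjoint of the partial derivative for the Gaussian inner product; its
    iterates on 1 are the Hermite polynomials in x_i. *)
Definition adjX (i : 'I_n) p := mulX i p \- partial i p.

Lemma Pol_adjX m i p : Pol m p -> Pol m.+1 (adjX i p).
Proof.
move=> pp; apply: PolB; first exact: Pol_mulX.
by apply: Pol_leq (Pol_partial i pp); case: m {pp} => // m; rewrite -addn2 leq_addr.
Qed.

Lemma ip_adjX m k i p q : Pol m p -> Pol k q -> ip (partial i p) q = ip p (adjX i q).
Proof.
move=> pp pq; have := weak_ibp (Pol_L2 pp) (L2_row_partial i pp) (weak_gradient_Pol pp) pq.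
by under [X in ip X _ = _]eq_fun do rewrite mxE.
Qed.

(** By the density of the polynomials, f - f' is orthogonal to itself. Moments are
    what integration by parts gives access to, which makes this the tool for
    comparing weak gradients. *)
Lemma ip_eq_moments f f' : L2 f -> L2 f' ->
  (forall m q, Pol m q -> ip f q = ip f' q) -> ip f f = ip f' f'.
Proof.
move=> lf lf' E; have lB := L2B lf lf'.
have B0 : ip (f \- f') (f \- f') = 0.
  have [_ ap] := approx_L2 lB; apply/eqP/negP => /negP nz.
  have pos : 0 < ip (f \- f') (f \- f') by rewrite lt_def nz ip_ge0.
  have [m [p [pp]]] := ap _ pos; have lp := Pol_L2 pp.
  have lBp := L2B lB lp.
  have z : ip (f \- f') p = 0 by rewrite ipBl// (E _ _ pp) subrr.
  rewrite (ipBl lB lp lBp) (ipBr lB lp lB) (ipBr lB lp lp) (ipC p (f \- f')) z.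
  by have := ip_ge0 p; lra.
have h1 := ip_eq0r lf lB B0; have h2 := ip_eq0r lf' lB B0.
by move: h1 h2; rewrite !ipBr// (ipC f' f); lra.
Qed.

End classical_gradient.

(** * Orthogonal projections on polynomials of bounded degree *)

Section finite_dimensional.
Context (R : realType) (n : nat).
Implicit Types (u v w p q e f : 'rV[R]_n -> R) (V W : set ('rV[R]_n -> R)).

(** Adjoining spanning functions one at a time, without a condition of linear
    independence, gives the induction on which Gram-Schmidt orthogonalisation
    runs. *)
Inductive findim : set ('rV[R]_n -> R) -> Prop :=
| findim0 : findim [set f | f = cst 0]
| findimS V e m : findim V -> Pol m e ->
    findim [set f | exists c w, V w /\ f = (c \*o e) \+ w].

Lemma findim_L2 V f : findim V -> V f -> L2 f.
Proof.
move=> fV; elim: fV f => {V} [|V e m _ IH pe] f.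
  by move=> ->; apply: L2_moderate; exact: moderate_cst.
by move=> [c [w [Vw ->]]]; apply: L2D; [apply: L2Z; exact: Pol_L2 pe|exact: IH].
Qed.

Lemma ip0r u : ip u (cst 0) = 0.
Proof.
by rewrite /ip; under eq_Rintegral do rewrite mulr0; rewrite /Rintegral integral0.
Qed.

(** Orthogonal projection on a finite-dimensional space, by Gram-Schmidt; when the
    adjoined function has null residual, it does not change the projection. *)
Lemma findim_projection V u : findim V -> L2 u ->
  exists w, V w /\ forall q, V q -> ip (u \- w) q = 0.
Proof.
move=> fV; elim: fV u => {V} [|V e m fV IH pe] u lu.
  by exists (cst 0); split => // q ->; exact: ip0r.
have le := Pol_L2 pe; have [b [Vb ob]] := IH _ le.
have lb := findim_L2 fV Vb; have lr := L2B le lb.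
pose c := ip u (e \- b) / ip (e \- b) (e \- b).
have lce := L2Z c le; have luce := L2B lu lce.
have [a [Va oa]] := IH _ luce; have la := findim_L2 fV Va.
have lres := L2B luce la.
exists ((c \*o e) \+ a); split; first by exists c, a.
move=> _ [d [w [Vw ->]]]; have lw := findim_L2 fV Vw.
rewrite (_ : u \- _ = (u \- (c \*o e)) \- a); last by apply/funext => x /=; rewrite opprD addrA.
rewrite ipDr//; last exact: L2Z.
rewrite ipZr// (oa _ Vw) addr0.
suff -> : ip ((u \- (c \*o e)) \- a) e = 0 by rewrite mulr0.
have -> : ip ((u \- (c \*o e)) \- a) e = ip ((u \- (c \*o e)) \- a) (e \- b).
  by rewrite [RHS]ipBr// (oa _ Vb) subr0.
have [z|nz] := eqVneq (ip (e \- b) (e \- b)) 0; first exact: ip_eq0r.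
have ar : ip a (e \- b) = 0 by rewrite ipC; exact: ob.
have er : ip e (e \- b) = ip (e \- b) (e \- b).
  by rewrite (ipBl le lb lr) (ipC b) (ob _ Vb) subr0.
by rewrite !ipBl// ipZl// ar er subr0 /c divfK// subrr.
Qed.

Lemma findim_mulX i V W : findim V -> findim W ->
  findim [set f | exists v w, [/\ V v, W w & f = v \+ mulX i w]].
Proof.
move=> fV; elim => {W} [|W e m fW IH pe].
  rewrite [X in findim X](_ : _ = V)//; apply/seteqP; split=> f /=.
    move=> [v [w [Vv -> ->]]]; rewrite (_ : _ \+ _ = v)//.
    by apply/funext => x /=; rewrite /mulX mulr0 addr0.
  move=> Vf; exists f, (cst 0); split => //.
  by apply/funext => x /=; rewrite /mulX mulr0 addr0.
rewrite [X in findim X](_ : _ = [set f | exists c w,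
    [set f | exists v w, [/\ V v, W w & f = v \+ mulX i w]] w /\ f = (c \*o mulX i e) \+ w]).
  exact: (findimS IH (Pol_mulX i pe)).
apply/seteqP; split=> f /=.
  move=> [v [_ [Vv [c [w [Ww ->]] ->]]]]; exists c, (v \+ mulX i w); split; first by exists v, w.
  by apply/funext => x; rewrite /mulX/=; ring.
move=> [c [_ [[v [w [Vv Ww ->]]] ->]]]; exists v, ((c \*o e) \+ w); split => //.
  by exists c, w.
by apply/funext => x; rewrite /mulX/=; ring.
Qed.

Lemma Pol0_cst f : Pol 0 f -> exists c, f = cst c.
Proof.
suff gen m : Pol m f -> m = 0%N -> exists c, f = cst c by move=> /gen; apply.
elim => {m f} [m c _|//|m f g _ IHf _ IHg E].
  by exists c.
have [a ->] := IHf E; have [b ->] := IHg E; exists (a + b).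
by apply/funext.
Qed.

(** The polynomials of degree at most m + 1 are the sums of one of degree at most m
    and of the products of such polynomials by each of the coordinates; [S] adds the
    coordinates one after the other. *)
Lemma findim_Pol m : findim (Pol m).
Proof.
elim: m => [|m IH].
  rewrite (_ : Pol 0 = [set f | exists c w, [set f | f = cst 0] w /\ f = (c \*o cst 1) \+ w]).
    by apply: (findimS findim0); exact: (Pol_cst _ 0).
  apply/seteqP; split=> f /=.
    move=> /Pol0_cst[c ->]; exists c, (cst 0); split => //.
    by apply/funext => x /=; rewrite mulr1 addr0.
  move=> [c [w [-> ->]]]; rewrite (_ : _ \+ _ = cst c); first exact: Pol_cst.
  by apply/funext => x /=; rewrite mulr1 addr0.
pose fix S (s : seq 'I_n) : set ('rV[R]_n -> R) := if s is i :: s' then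
  [set f | exists v w, [/\ S s' v, Pol m w & f = v \+ mulX i w]] else Pol m.
have fS s : findim (S s) by elim: s => //= i s IHs; exact: findim_mulX.
have SD s f g : S s f -> S s g -> S s (f \+ g).
  elim: s f g => /= [|i s IHs] f g; first exact: PolD.
  move=> [v [w [Sv pw ->]]] [v' [w' [Sv' pw' ->]]].
  exists (v \+ v'), (w \+ w'); split; [exact: IHs|exact: PolD|].
  by apply/funext => x; rewrite /mulX/=; ring.
have Scons i s f : S s f -> S (i :: s) f.
  move=> Sf; exists f, (cst 0); split => //; first exact: Pol_cst.
  by apply/funext => x; rewrite /mulX/= mulr0 addr0.
have S0 s f : Pol m f -> S s f.
  by move=> pf; elim: s => // i s IHs; exact: Scons.
have SX s i f : i \in s -> Pol m f -> S s (mulX i f).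
  elim: s => // j s IHs; rewrite inE => /predU1P[-> pf|is_ pf].
    exists (cst 0), f; split => //; first by apply: S0; exact: Pol_cst.
    by apply/funext => x; rewrite /= add0r.
  by apply: Scons; exact: IHs.
rewrite (_ : Pol m.+1 = S (enum 'I_n))//; apply/seteqP; split=> f.
  have gen k : Pol k f -> k = m.+1 -> S (enum 'I_n) f; last by move=> /gen; apply.
  elim => {k f} [k c _|k i f pf _ [E]|k f g _ IHf _ IHg E].
  - by apply: S0; exact: Pol_cst.
  - by apply: SX; [rewrite mem_enum|rewrite -E].
  - by apply: SD; [exact: IHf|exact: IHg].
elim: (enum _) f => [|i s IHs] f /=; first exact: Pol_leq.
move=> [v [w [Sv pw ->]]]; apply: PolD; [exact: IHs|exact: Pol_mulX].
Qed.

Definition is_proj m u v := Pol m v /\ forall q, Pol m q -> ip (u \- v) q = 0.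

Definition Pproj m u : 'rV[R]_n -> R := xget (cst 0) (is_proj m u).

Lemma PprojP m u : L2 u -> is_proj m u (Pproj m u).
Proof.
by move=> lu; exact: (@xgetPex _ (cst 0) _ (findim_projection (findim_Pol m) lu)).
Qed.

Lemma is_proj_pythagoras m u v q : L2 u -> is_proj m u v -> Pol m q ->
  ip (u \- q) (u \- q) = ip (u \- v) (u \- v) + ip (v \- q) (v \- q).
Proof.
move=> lu [pv ov] pq; have lv := Pol_L2 pv; have lq := Pol_L2 pq.
rewrite (_ : u \- q = (u \- v) \+ (v \- q)); last by apply/funext => x /=; ring.
have luv := L2B lu lv; have lvq := L2B lv lq; have lD := L2D luv lvq.
have z : ip (u \- v) (v \- q) = 0 by apply: ov; exact: PolB.
by rewrite (ipDl luv lvq lD) (ipDr luv lvq luv) (ipDr luv lvq lvq) (ipC (v \- q)) z addr0 add0r.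
Qed.

Lemma is_proj_min m u v q : L2 u -> is_proj m u v -> Pol m q ->
  ip (u \- v) (u \- v) <= ip (u \- q) (u \- q).
Proof.
by move=> lu pv pq; rewrite (is_proj_pythagoras lu pv pq) lerDl ip_ge0.
Qed.

(** Projections minimise the distance, hence they do at least as well as the
    approximations given by the density of the polynomials. *)
Lemma is_proj_cvg0 u (v : nat -> 'rV[R]_n -> R) : L2 u -> (forall m, is_proj m u (v m)) ->
  ip (u \- v m) (u \- v m) @[m --> \oo] --> 0.
Proof.
move=> lu pv; apply/cvgrPdist_lt => e e0.
have [_ /(_ _ e0) [m [p [pp pe]]]] := approx_L2 lu.
exists m => // k /= mk; rewrite sub0r normrN ger0_norm ?ip_ge0//.
by apply: le_lt_trans pe; apply: (is_proj_min lu (pv k)); exact: Pol_leq pp.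
Qed.

End finite_dimensional.

(** * The number operator and the recurrence *)

Section euler.
Context (R : realType) (n : nat).
Implicit Types (u p q f h : 'rV[R]_n -> R).

Lemma partialB m k i p q : Pol m p -> Pol k q ->
  partial i (p \- q) = partial i p \- partial i q.
Proof.
move=> pp pq; have E : p \- q = p \+ (-1 \*o q) by apply/funext => x /=; rewrite mulN1r.
rewrite E partialD; [|exact: Pol_diffable pp|exact: Pol_diffable (PolZ (-1) pq)].
rewrite partialZ; last exact: Pol_diffable pq.
by apply/funext => x /=; rewrite mulN1r.
Qed.

Definition euler_op p : 'rV[R]_n -> R := fun x => \sum_(i < n) x 0 i * partial i p x.

(** Euler's identity for homogeneous polynomials, read modulo lower degree. As
    [0.-1] is 0, the bound on the degree of r does not give that of x_j r when m = 0;
    the second condition supplies it to the induction. *)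
Lemma euler_identity m p : Pol m p -> exists r,
  [/\ Pol m.-1 r, forall j, Pol m (mulX j r) & euler_op p = (m%:R \*o p) \+ r].
Proof.
elim => {m p} [m c|m j f pf [r [pr prX fr]]|m f g pf [r [pr prX fr]] pg [s [ps psX gs]]].
- exists (cst (- (m%:R * c))); split; first exact: Pol_cst.
    case: m => [|m] j; last by apply: (@Pol_leq _ _ 1) => //; apply: Pol_mulX; exact: Pol_cst.
    rewrite (_ : mulX _ _ = cst 0); first exact: Pol_cst.
    by apply/funext => x; rewrite /mulX /= mul0r oppr0 mulr0.
  apply/funext => x; rewrite /euler_op big1 => [|i _]; first by rewrite /= subrr.
  by rewrite partial_cst mulr0.
- exists (mulX j r); split; [exact: prX|by move=> k; exact: Pol_mulX|].
  apply/funext => x; rewrite /euler_op.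
  have df := Pol_diffable pf.
  under eq_bigr do rewrite (partial_mulX _ _ df) /= mulrDr.
  rewrite big_split/= [X in _ + X](bigD1 j)//= eqxx mul1r [X in _ + (_ + X)]big1 ?addr0 => [|i ij]; last first.
    by rewrite eq_sym (negbTE ij) mul0r mulr0.
  under eq_bigr do rewrite /mulX mulrCA.
  rewrite -mulr_sumr -/(euler_op f x) fr /mulX/= -natr1; ring.
- exists (r \+ s); split; first exact: PolD.
    move=> j; rewrite (_ : mulX _ _ = mulX j r \+ mulX j s); first exact: PolD.
    by apply/funext => x; rewrite /mulX/= mulrDr.
  apply/funext => x; rewrite /euler_op.
  have df := Pol_diffable pf; have dg := Pol_diffable pg.
  under eq_bigr do rewrite (partialD _ df dg) /= mulrDr.
  rewrite big_split/= -/(euler_op f x) -/(euler_op g x) fr gs/=; ring.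
Qed.

(** The number operator differs from Euler's operator by the Laplacian, which lowers
    the degree by two. *)
Lemma number_operator m p : Pol m.+1 p -> exists2 r, Pol m r &
  (fun x => \sum_(i < n) adjX i (partial i p) x) = (m.+1%:R \*o p) \+ r.
Proof.
move=> pp; have [r [pr _ er]] := euler_identity pp.
exists (r \- (fun x => \sum_(i < n) partial i (partial i p) x)).
  apply: PolB => //; apply: Pol_sum => i.
  by apply: Pol_leq (Pol_partial i (Pol_partial i pp)) => /=; exact: leq_pred.
apply/funext => x; transitivity (euler_op p x - \sum_(i < n) partial i (partial i p) x).
  by rewrite /euler_op -sumrB.
by rewrite er /=; ring.
Qed.

End euler.

Section spectral.
Context (R : realType) (n : nat).
Local Notation gamma := (gaussian R n).
Implicit Types (u v p q f h : 'rV[R]_n -> R).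

Definition gradc u i : 'rV[R]_n -> R := fun x => grad u x 0 i.

(** In terms of the Hermite components u_k of u, [dist2 u m] is the sum over k > m of
    |u_k|^2, and [gdist2 u m] is the sum over k > m of k |u_k|^2. *)
Definition dist2 u m : R := ip (u \- Pproj m u) (u \- Pproj m u).
Definition gdist2 u m : R := \sum_(i < n)
  ip (gradc u i \- partial i (Pproj m u)) (gradc u i \- partial i (Pproj m u)).

Lemma W12_L2 u : W12 R n u -> L2 u.
Proof. by move=> /W12P[]. Qed.

Lemma L2_gradc u i : W12 R n u -> L2 (gradc u i).
Proof. by move=> /W12P[_ _ lg]; exact: lg. Qed.

Lemma gradc_ibp u m p i : W12 R n u -> Pol m p -> ip (gradc u i) p = ip u (adjX i p).
Proof. by move=> /W12P[lu wu lg] pp; exact: weak_ibp lu (lg i) wu pp. Qed.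

(** Differentiation lowers the degree and its adjoint raises it by one: u minus its
    projection on degree m + 1 is orthogonal to the image of degree m under the
    adjoint. *)
Lemma is_proj_gradc u m i : W12 R n u -> is_proj m (gradc u i) (partial i (Pproj m.+1 u)).
Proof.
move=> Wu; have lu := W12_L2 Wu; have [pU oU] := PprojP m.+1 lu.
have pdU := Pol_partial i pU; split => // q pq.
have lq := Pol_L2 pq; have pA := Pol_adjX i pq; have lA := Pol_L2 pA.
rewrite (ipBl (L2_gradc i Wu) (Pol_L2 pdU) lq) (gradc_ibp i Wu pq) (ip_adjX i pU pq).
by rewrite -(ipBl lu (Pol_L2 pU) lA) oU.
Qed.

Lemma ip_sumr f m (F : 'I_n -> 'rV[R]_n -> R) : L2 f -> (forall i, Pol m (F i)) ->
  ip f (fun x => \sum_(i < n) F i x) = \sum_(i < n) ip f (F i).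
Proof.
move=> lf pF.
suff gen (s : seq 'I_n) : ip f (fun x => \sum_(i <- s) F i x) = \sum_(i <- s) ip f (F i).
  exact: gen.
elim: s => [|i s IH].
  by rewrite big_nil -[RHS](ip0r f); congr ip; apply/funext => x; rewrite big_nil.
rewrite big_cons -IH -ipDr//; first by congr ip; apply/funext => x; rewrite big_cons.
- exact: Pol_L2 (pF i).
- exact: Pol_L2 (Pol_sum s pF).
Qed.

Lemma dist2_succ u m : L2 u -> dist2 u m =
  dist2 u m.+1 + ip (Pproj m.+1 u \- Pproj m u) (Pproj m.+1 u \- Pproj m u).
Proof.
move=> lu; rewrite /dist2 (is_proj_pythagoras lu (PprojP m.+1 lu))//.
by have [pU _] := PprojP m lu; exact: Pol_leq pU.
Qed.

(** The difference h of the two successive projections has degree m + 1 and is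
    orthogonal to degree m. By the Pythagorean identity both differences of squared
    distances are expressed by h alone, as the sum of the |d_i h|^2 on the left and as
    |h|^2 on the right, and the number operator relates them. *)
Lemma gdist2_succ u m : W12 R n u ->
  gdist2 u m - gdist2 u m.+1 = m.+1%:R * (dist2 u m - dist2 u m.+1).
Proof.
move=> Wu; have lu := W12_L2 Wu.
have [pU oU] := PprojP m lu; have [pV oV] := PprojP m.+1 lu.
have pU' : Pol m.+1 (Pproj m u) by exact: Pol_leq pU.
pose h := Pproj m.+1 u \- Pproj m u; have ph : Pol m.+1 h by exact: PolB.
have lh := Pol_L2 ph.
have oh q : Pol m q -> ip h q = 0.
  move=> pq; have lq := Pol_L2 pq.
  have -> : h = (u \- Pproj m u) \- (u \- Pproj m.+1 u) by apply/funext => x; rewrite /h/=; ring.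
  have l1 := L2B lu (Pol_L2 pU); have l2 := L2B lu (Pol_L2 pV).
  by rewrite (ipBl l1 l2 lq) oU// oV ?subrr//; exact: Pol_leq pq.
rewrite (dist2_succ m lu) -/h (addrC (dist2 u m.+1)) addrK.
rewrite /gdist2 -sumrB.
have E i : ip (gradc u i \- partial i (Pproj m u)) (gradc u i \- partial i (Pproj m u)) -
    ip (gradc u i \- partial i (Pproj m.+1 u)) (gradc u i \- partial i (Pproj m.+1 u)) =
    ip h (adjX i (partial i h)).
  rewrite (is_proj_pythagoras (L2_gradc i Wu) (is_proj_gradc m i Wu)); last first.
    by apply: Pol_leq (Pol_partial i pU); exact: leq_pred.
  rewrite addrC addKr -(partialB i pV pU') -/h.
  exact: ip_adjX ph (Pol_partial i ph).
rewrite (eq_bigr _ (fun i _ => E i)).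
rewrite -(@ip_sumr _ m.+1) => [|//|i]; last exact: Pol_adjX (Pol_partial i ph).
have [r pr ->] := number_operator ph; have lr := Pol_L2 pr.
by rewrite (ipDr (L2Z _ lh) lr lh) (ipZr _ lh lh) (oh _ pr) addr0.
Qed.

Lemma dist2_ge0 u m : 0 <= dist2 u m.
Proof. exact: ip_ge0. Qed.

Lemma dist2_noninc u m : L2 u -> dist2 u m.+1 <= dist2 u m.
Proof. by move=> lu; rewrite (dist2_succ m lu) lerDl ip_ge0. Qed.

Lemma dist2_cvg u : L2 u -> dist2 u m @[m --> \oo] --> 0.
Proof. by move=> lu; apply: is_proj_cvg0 => // m; exact: PprojP. Qed.

Lemma gdist2_cvg u : W12 R n u -> gdist2 u m @[m --> \oo] --> 0.
Proof.
move=> Wu; rewrite -cvg_shiftS /=.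
(* [is_proj_gradc] starts at degree 1, hence the shift. *)
pose a i m := ip (gradc u i \- partial i (Pproj m.+1 u)) (gradc u i \- partial i (Pproj m.+1 u)).
suff gen (s : seq 'I_n) : \sum_(i <- s) a i m @[m --> \oo] --> (0 : R) by exact: gen.
elim: s => [|i s IH].
  by under eq_fun do rewrite big_nil; exact: cvg_cst.
under eq_fun do rewrite big_cons.
have ai : a i m @[m --> \oo] --> (0 : R).
  by apply: (is_proj_cvg0 (L2_gradc i Wu)) => m; exact: is_proj_gradc.
have h := cvgD ai IH; rewrite addr0 in h; exact: h.
Qed.

Lemma sqL2vE (v : 'rV[R]_n -> 'rV[R]_n) : (forall i, L2 (fun x => v x 0 i)) ->
  sqL2v v = (\sum_(i < n) ip (fun x => v x 0 i) (fun x => v x 0 i))%:E.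
Proof.
move=> lv; rewrite /sqL2v /sqnorm /dotrV -sumEFin.
rewrite (eq_integral (fun x => \sum_(i < n) (v x 0 i * v x 0 i)%:E)%E); last first.
  by move=> x _; rewrite sumEFin.
rewrite ge0_integral_sum//; last 2 first.
- by move=> i; apply/measurable_EFinP; have [mv _] := lv i; exact: measurable_funM.
- by move=> i x _; rewrite lee_fin -expr2 sqr_ge0.
apply: eq_bigr => i _; rewrite -sqL2E// /sqL2.
Qed.

(** [grad] selects some weak gradient of u - p; its moments determine it, and they
    are those of the weak gradient of u minus the classical gradient of p. *)
Lemma sqL2v_grad_sub u m p : W12 R n u -> Pol m p ->
  sqL2v (grad (fun x => u x - p x)) =
  (\sum_(i < n) ip (gradc u i \- partial i p) (gradc u i \- partial i p))%:E.
Proof.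
move=> Wu pp; have Wup := W12_subPol Wu pp.
rewrite sqL2vE; last by move=> i; exact: L2_gradc Wup.
congr (_%:E); apply: eq_bigr => i _.
have ldp := Pol_L2 (Pol_partial i pp); have lg := L2_gradc i Wu.
apply: ip_eq_moments; [exact: L2_gradc Wup|exact: L2B|].
move=> k q pq; have lq := Pol_L2 pq; have lA := Pol_L2 (Pol_adjX i pq).
rewrite (gradc_ibp i Wup pq) (ipBl lg ldp lq) (gradc_ibp i Wu pq) (ip_adjX i pp pq).
by rewrite -(ipBl (W12_L2 Wu) (Pol_L2 pp) lA).
Qed.

(** The gradient of the projection of u is optimal in each component separately. *)
Lemma gdist2_min u m p : W12 R n u -> Pol m p ->
  gdist2 u m <= \sum_(i < n) ip (gradc u i \- partial i p) (gradc u i \- partial i p).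
Proof.
move=> Wu pp; apply: ler_sum => i _; case: m pp => [|m] pp.
  have [pU _] := PprojP 0 (W12_L2 Wu).
  by have [c ->] := Pol0_cst pp; have [d ->] := Pol0_cst pU; rewrite !partial_cst.
apply: (is_proj_min (L2_gradc i Wu) (is_proj_gradc m i Wu)).
exact: (Pol_partial i pp).
Qed.

Lemma ereal_inf_min (A : set (\bar R)) (x : \bar R) : A x -> (forall y, A y -> (x <= y)%E) ->
  ereal_inf A = x.
Proof.
by move=> Ax xA; apply/eqP; rewrite eq_le ereal_inf_lbound//=; exact: le_ereal_inf_tmp.
Qed.

Lemma inf_Pol_dist2 u m : L2 u ->
  ereal_inf [set sqL2 (fun x => u x - p x) | p in Pol m] = (dist2 u m)%:E.
Proof.
move=> lu; have [pU oU] := PprojP m lu; apply: ereal_inf_min.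
  by exists (Pproj m u) => //; rewrite sqL2E//; exact: L2B lu (Pol_L2 pU).
move=> _ [p pp <-]; rewrite sqL2E; last exact: L2B lu (Pol_L2 pp).
by rewrite lee_fin; exact: (is_proj_min lu (PprojP m lu) pp).
Qed.

Lemma inf_Pol_gdist2 u m : W12 R n u ->
  ereal_inf [set sqL2v (grad (fun x => u x - p x)) | p in Pol m] = (gdist2 u m)%:E.
Proof.
move=> Wu; have [pU oU] := PprojP m (W12_L2 Wu); apply: ereal_inf_min.
  by exists (Pproj m u) => //; rewrite (sqL2v_grad_sub Wu pU).
by move=> _ [p pp <-]; rewrite (sqL2v_grad_sub Wu pp) lee_fin; exact: gdist2_min.
Qed.

Lemma sqL2v_grad u : W12 R n u -> sqL2v (grad u) = (gdist2 u 0)%:E.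
Proof.
move=> Wu; rewrite sqL2vE; last by move=> i; exact: L2_gradc Wu.
have [pU _] := PprojP 0 (W12_L2 Wu); have [c cE] := Pol0_cst pU.
congr (_%:E); apply: eq_bigr => i _; rewrite cE partial_cst.
by congr ip; apply/funext => x /=; rewrite subr0.
Qed.

(** The constant fields are the gradients of the polynomials of degree at most 1. *)
Lemma dist_grad_constE u : W12 R n u -> dist_grad_const u = (gdist2 u 1)%:E.
Proof.
move=> Wu; have gE (d : 'rV[R]_n) : sqL2v (fun x => grad u x - d) =
    (\sum_(i < n) ip (gradc u i \- cst (d 0 i)) (gradc u i \- cst (d 0 i)))%:E.
  have E i : (fun x => (grad u x - d) 0 i) = gradc u i \- cst (d 0 i).
    by apply/funext => x; rewrite !mxE.
  rewrite sqL2vE => [|i]; last first.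
    by rewrite E; apply: L2B; [exact: L2_gradc|apply: L2_moderate; exact: moderate_cst].
  by congr (_%:E); apply: eq_bigr => i _; rewrite E.
apply: ereal_inf_min => [|_ [d _ <-]].
  have hd i : exists c, partial i (Pproj 1 u) = cst c.
    by apply: Pol0_cst; have [] := is_proj_gradc 0 i Wu.
  exists (\row_i sval (cid (hd i))) => //; rewrite gE; congr (_%:E).
  apply: eq_bigr => i _; rewrite mxE; by case: (cid (hd i)) => c /= ->.
rewrite gE lee_fin; apply: ler_sum => i _.
apply: (is_proj_min (L2_gradc i Wu) (is_proj_gradc 0 i Wu)); exact: Pol_cst.
Qed.

Lemma dist2_eq0_ae u m : L2 u -> dist2 u m = 0 <->
  exists2 p, Pol m p & {ae gamma, forall x, u x = p x}.
Proof.
move=> lu; have [pU oU] := PprojP m lu; split=> [d0|[p pp up]].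
  exists (Pproj m u) => //; have := ip_eq0_ae (L2B lu (Pol_L2 pU)) d0.
  by apply: filterS => x /= /eqP; rewrite subr_eq0 => /eqP.
apply/eqP; rewrite eq_le dist2_ge0 andbT; apply: (le_trans (is_proj_min lu (PprojP m lu) pp)).
have lB := L2B lu (Pol_L2 pp); have [mB _] := lB.
rewrite (@ip_ae _ _ _ (cst 0))//.
  by rewrite ipC ip0r.
by apply: filterS up => x /= ->; rewrite subrr.
Qed.

End spectral.

(** * Multivariate polynomials as functions *)

Section polyfun_Pol.
Context (R : realType) (n : nat).
Implicit Types (p q f h : 'rV[R]_n -> R).

Lemma Pol_monomial (k : 'I_n -> nat) (s : seq 'I_n) :
  Pol (\sum_(i <- s) k i)%N (fun x : 'rV[R]_n => \prod_(i <- s) x 0 i ^+ k i).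
Proof.
elim: s => [|i s IH].
  rewrite (_ : (fun x => _) = cst 1); first exact: Pol_cst.
  by apply/funext => x; rewrite big_nil.
rewrite big_cons (_ : (fun x => _) = (fun x : 'rV[R]_n => x 0 i ^+ k i) \*
    (fun x => \prod_(i <- s) x 0 i ^+ k i)); last first.
  by apply/funext => x; rewrite big_cons.
apply: PolM => //; elim: (k i) => [|j IHj]; first exact: (Pol_cst _ 0 1).
rewrite (_ : (fun x => _) = mulX i (fun x : 'rV[R]_n => x 0 i ^+ j)); first exact: Pol_mulX.
by apply/funext => x; rewrite exprS.
Qed.

Lemma polyfun_Pol m : @polyfun R n m = Pol m.
Proof.
apply/seteqP; split=> f.
  move=> [p pm ->].
  under eq_fun do rewrite mevalE.
  have : all (fun mon => (mdeg mon <= m)%N) (msupp p).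
    by apply/allP => mon /msize_mdeg_lt h; have := leq_trans h pm.
  elim: (msupp p) => [_|mon s IH /= /andP[mon_m /IH pols]].
    rewrite (_ : (fun x => _) = cst 0); first exact: Pol_cst.
    by apply/funext => x; rewrite big_nil.
  rewrite (_ : (fun x => _) = (mcoeff mon p \*o (fun x : 'rV[R]_n => \prod_(i < n) x 0 i ^+ mon i))
      \+ (fun x : 'rV[R]_n => \sum_(mon <- s) mcoeff mon p * \prod_(i < n) x 0 i ^+ mon i)); last first.
    by apply/funext => x; rewrite big_cons.
  apply: PolD => //; apply: PolZ; apply: Pol_leq (Pol_monomial _ _).
  by rewrite -mdegE.
elim => {m f} [m c|m i f _ [p pm ->]|m f g _ [p pm ->] _ [q qm ->]].
- exists (mpolyC n c); first by rewrite mmeasureC ?mdeg0//; case: (_ != _).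
  by apply/funext => x; rewrite mevalC.
- exists (p * mpolyX R (mnm1 i)); last first.
    by apply/funext => x; rewrite mevalM mevalXU mulrC.
  have [->|p0] := eqVneq p 0; first by rewrite mul0r mmeasure0.
  have X0 : mpolyX R (mnm1 i) != 0 by rewrite -msize_poly_eq0 msizeX.
  by rewrite msizeM// msizeX mdeg1 addn2.
- exists (p + q); last by apply/funext => x; rewrite mevalD.
  by apply: (leq_trans (mmeasureD_le _ _ _)); rewrite geq_max pm qm.
Qed.

End polyfun_Pol.

(** * Consequences of the recurrence *)

Section sequences_identities.
Context (R : realType) (D E : nat -> R).
Hypothesis D_ge0 : forall m, 0 <= D m.
Hypothesis D_noninc : forall m, D m.+1 <= D m.
Hypothesis D_cvg : D m @[m --> \oo] --> 0.
Hypothesis E_cvg : E m @[m --> \oo] --> 0.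
Hypothesis ED : forall m, E m - E m.+1 = m.+1%:R * (D m - D m.+1).

(** When D_m and E_m are the sums over k > m of a_k and of k a_k, this is the sum over
    k > m + 1 of (k - m - 1) a_k. *)
Definition gap m : R := E m - m.+1%:R * D m.

Lemma gap_succ m : gap m = gap m.+1 + D m.+1.
Proof.
have := ED m; rewrite /gap -[m.+2%:R]natr1 => h.
have -> : E m = E m.+1 + m.+1%:R * (D m - D m.+1) by rewrite -h; ring.
ring.
Qed.

(** Summed from m on, the recurrence has coefficients at least m + 1, so that
    (m + 1) (D_m - D_(m+k)) <= E_m - E_(m+k); then k tends to infinity. *)
Lemma gap_ge0 m : 0 <= gap m.
Proof.
have step k : m.+1%:R * (D m - D (m + k)%N) <= E m - E (m + k)%N.
  elim: k => [|k IH]; first by rewrite addn0 !subrr mulr0.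
  rewrite addnS; have h := ED (m + k)%N.
  have h2 : m.+1%:R * (D (m + k)%N - D (m + k).+1) <= (m + k).+1%:R * (D (m + k)%N - D (m + k).+1).
    by apply: ler_wpM2r; [rewrite subr_ge0|rewrite ler_nat ltnS leq_addr].
  lra.
have c : E (k + m)%N - m.+1%:R * D (k + m)%N @[k --> \oo] --> (0 : R).
  rewrite -[X in _ --> X](subr0 (0 : R)) -[X in _ --> _ - X](mulr0 (m.+1%:R)).
  apply: cvgB; first by rewrite (@cvg_shiftn m _ E).
  by apply: cvgM; [exact: cvg_cst|rewrite (@cvg_shiftn m _ D)].
apply: (cvgr_to_le c); apply: nearW => k; rewrite /gap.
by have := step k; rewrite addnC; lra.
Qed.

Lemma gap_cvg : gap m @[m --> \oo] --> 0.
Proof.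
apply: (@squeeze_cvgr _ _ _ _ (cst 0) E) => //; last exact: cvg_cst.
apply: nearW => m; rewrite gap_ge0/= /gap gerBl.
by rewrite mulr_ge0.
Qed.

(** If D_(m+1) vanishes, so do all later terms, and the gaps are constant from m on;
    their limit is 0. *)
Lemma gap_eq0 m : gap m = 0 <-> D m.+1 = 0.
Proof.
split=> [g0|d0].
  have := gap_succ m; have := gap_ge0 m.+1; have := D_ge0 m.+1; lra.
have dk k : D (m + k).+1 = 0.
  elim: k => [|k IH]; first by rewrite addn0.
  by have := D_noninc (m + k).+1; have := D_ge0 (m + k).+2; rewrite IH addnS; lra.
have gk k : gap (k + m)%N = gap m.
  elim: k => [|k IH]; first by rewrite add0n.
  by rewrite -IH (gap_succ (k + m)%N) addSn [in D _]addnC dk addr0.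
have c : gap (k + m)%N @[k --> \oo] --> (0 : R) by rewrite (@cvg_shiftn m _ gap); exact: gap_cvg.
rewrite -[RHS](cvg_lim _ c)// (_ : (fun k => _) = cst (gap m)) ?lim_cst//.
by apply/funext => k; rewrite gk.
Qed.

Lemma sum_D : (\sum_(1 <= j <oo) (D j)%:E)%E = (gap 0)%:E.
Proof.
apply: cvg_lim => //; rewrite -cvg_shiftS /=.
have -> : (fun k => \sum_(1 <= j < k.+1) (D j)%:E)%E = (fun k => (gap 0 - gap k)%:E).
  apply/funext => k; elim: k => [|k IH]; first by rewrite big_geq// subrr.
  rewrite big_nat_recr//= IH -EFinD; congr (_%:E).
  by rewrite (gap_succ k); ring.
apply: cvg_EFin; first exact: nearW.
rewrite -[X in _ --> X]subr0; apply: cvgB; [exact: cvg_cst|exact: gap_cvg].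
Qed.

(** By the recurrence E_j / (j (j + 1)) = T_(j-1) - T_j for
    T_j = E_(j+1) / (j + 1) - D_(j+1), and T_0 = E_1 - D_1 = gap_0. *)
Lemma sum_E : (\sum_(1 <= j <oo) ((j * j.+1)%:R^-1)%:E * (E j)%:E)%E = (gap 0)%:E.
Proof.
pose T j := E j.+1 / j.+1%:R - D j.+1.
apply: cvg_lim => //; rewrite -cvg_shiftS /=.
have -> : (fun k => \sum_(1 <= j < k.+1) ((j * j.+1)%:R^-1)%:E * (E j)%:E)%E =
    (fun k => (gap 0 - T k)%:E).
  apply/funext => k; elim: k => [|k IH].
    by rewrite big_geq// gap_succ /gap /T divr1; congr (_%:E); ring.
  rewrite big_nat_recr//= IH -EFinM -EFinD; congr (_%:E).
  have h := ED k.+1.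
  have e : E k.+2 = E k.+1 - k.+2%:R * (D k.+1 - D k.+2) by rewrite -h; ring.
  have k1 : k.+1%:R != 0 :> R by rewrite pnatr_eq0.
  have k2 : k.+2%:R != 0 :> R by rewrite pnatr_eq0.
  rewrite /T e natrM; move: k1 k2; rewrite -[k.+2%:R]natr1.
  by move: (k.+1%:R : R) => a a0 a1; field; rewrite a0 a1.
apply: cvg_EFin; first exact: nearW.
rewrite -[X in _ --> X]subr0; apply: cvgB; first exact: cvg_cst.
rewrite /T -[X in _ --> X](subr0 (0 : R)); apply: cvgB; last by rewrite (@cvg_shiftS _ D).
rewrite -[X in _ --> X](mulr0 (0 : R)); apply: cvgM; first by rewrite (@cvg_shiftS _ E).
exact: cvg_harmonic.
Qed.

(** gap_0 = D_1 + gap_1 and E_1 / 2 = D_1 + gap_1 / 2: both defects are multiples of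
    gap_1. *)
Lemma sharp_stability :
  [/\ (D 1)%:E <= (gap 0)%:E, (gap 0)%:E = (D 1)%:E <-> D 2 = 0%R,
      (2^-1)%:E * (E 1)%:E <= (gap 0)%:E
    & (gap 0)%:E = (2^-1)%:E * (E 1)%:E <-> D 2 = 0%R]%E.
Proof.
have g0 := gap_succ 0; have g1 := gap_ge0 1; have gz := gap_eq0 1.
have e1 : E 1 = gap 1 + 2 * D 1 by rewrite /gap subrK.
rewrite -!EFinM !lee_fin; split.
- lra.
- by split=> [[h]|/gz h]; [apply/gz; lra|congr (_%:E); lra].
- lra.
- by split=> [[h]|/gz h]; [apply/gz; lra|congr (_%:E); lra].
Qed.

(** The defects of [sharp_stability] are gap_1 and gap_1 / 2, with
    gap_1 = D_2 + gap_2 and E_2 / 6 = D_2 / 2 + gap_2 / 6: what is left is gap_2 and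
    gap_2 / 3. *)
Lemma sharp_stability_of_stability :
  [/\ (D 2)%:E <= (gap 0)%:E - (D 1)%:E,
      (gap 0)%:E - (D 1)%:E = (D 2)%:E <-> D 3 = 0%R,
      (6^-1)%:E * (E 2)%:E <= (gap 0)%:E - (2^-1)%:E * (E 1)%:E
    & (gap 0)%:E - (2^-1)%:E * (E 1)%:E = (6^-1)%:E * (E 2)%:E <-> D 3 = 0%R]%E.
Proof.
have g0 := gap_succ 0; have g1 := gap_succ 1; have g2 := gap_ge0 2; have gz := gap_eq0 2.
have e1 : E 1 = gap 1 + 2 * D 1 by rewrite /gap subrK.
have e2 : E 2 = gap 2 + 3 * D 2 by rewrite /gap subrK.
rewrite -!EFinM -!EFinB !lee_fin; split.
- lra.
- by split=> [[h]|/gz h]; [apply/gz; lra|congr (_%:E); lra].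
- lra.
- by split=> [[h]|/gz h]; [apply/gz; lra|congr (_%:E); lra].
Qed.

(** A sequence that stops right after the first term that matters attains equality
    with a nonzero right-hand side, which bounds every admissible constant. *)
Lemma sharp_constants C : (0 < D 1 -> D 2 = 0 ->
    (C%:E * (D 1)%:E <= (gap 0)%:E)%E -> C <= 1) /\
  (0 < D 1 -> D 2 = 0 -> (C%:E * (E 1)%:E <= (gap 0)%:E)%E -> C <= 2^-1) /\
  (0 < D 2 -> D 3 = 0 -> (C%:E * (D 2)%:E <= (gap 0)%:E - (D 1)%:E)%E -> C <= 1) /\
  (0 < D 2 -> D 3 = 0 ->
    (C%:E * (E 2)%:E <= (gap 0)%:E - (2^-1)%:E * (E 1)%:E)%E -> C <= 6^-1).
Proof.
have g0 := gap_succ 0; have g1 := gap_succ 1.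
have e1 : E 1 = gap 1 + 2 * D 1 by rewrite /gap subrK.
have e2 : E 2 = gap 2 + 3 * D 2 by rewrite /gap subrK.
rewrite -!EFinM -!EFinB !lee_fin; split; last split; last split.
- by move=> d /(gap_eq0 1) z h; rewrite -(ler_pM2r d); lra.
- by move=> d /(gap_eq0 1) z; rewrite e1 z => h; rewrite -(ler_pM2r d); lra.
- by move=> d /(gap_eq0 2) z h; rewrite -(ler_pM2r d); lra.
- by move=> d /(gap_eq0 2) z; rewrite e2 z => h; rewrite -(ler_pM2r d); lra.
Qed.

End sequences_identities.

(** * The distances of the statement, and extremal functions *)

Section distances.
Context (R : realType) (n : nat).
Local Notation gamma := (gaussian R n).
Implicit Types (u p q f h : 'rV[R]_n -> R).

Lemma Pol1_affine f : Pol 1 f -> exists c (a : 'rV[R]_n), f = fun x => c + dotrV a x.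
Proof.
suff gen m : Pol m f -> m = 1%N -> exists c (a : 'rV[R]_n), f = fun x => c + dotrV a x.
  by move=> /gen; apply.
have cE c : cst c = fun x : 'rV[R]_n => c + dotrV 0 x.
  by apply/funext => x; rewrite /dotrV big1 ?addr0// => i _; rewrite mxE mul0r.
elim => {m f} [m c _|m i f pf _ [m0]|m f g _ IHf _ IHg E].
- by exists c, 0; rewrite cE.
- rewrite m0 in pf; have [c ->] := Pol0_cst pf; exists 0, (\row_j (if j == i then c else 0)).
  apply/funext => x; rewrite /mulX /dotrV/= (bigD1 i)//= big1 ?mxE ?eqxx => [|j ji].
    by rewrite addr0 add0r mulrC.
  by rewrite mxE (negbTE ji) mul0r.
have [c [a ->]] := IHf E; have [d [b ->]] := IHg E; exists (c + d), (a + b).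
apply/funext => x /=; rewrite addrACA; congr (_ + _).
by rewrite /dotrV -big_split/=; apply: eq_bigr => i _; rewrite mxE mulrDl.
Qed.

Lemma Pol_affine c (a : 'rV[R]_n) : Pol 1 (fun x => c + dotrV a x).
Proof.
rewrite (_ : (fun x => _) = cst c \+ (fun x => \sum_(i < n) (a 0 i \*o (fun x : 'rV[R]_n => x 0 i)) x))//.
apply: PolD; first exact: Pol_cst.
by apply: Pol_sum => i; apply: PolZ; exact: Pol_coord.
Qed.

Lemma dist_polyE u m : L2 u -> dist_poly m u = (dist2 u m)%:E.
Proof. by move=> lu; rewrite -inf_Pol_dist2// /dist_poly polyfun_Pol. Qed.

Lemma dist_constE u : L2 u -> dist_const u = (dist2 u 0)%:E.
Proof.
move=> lu; rewrite -inf_Pol_dist2//; congr ereal_inf; apply/seteqP; split=> y.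
  by move=> [c _ <-]; exists (cst c) => //; exact: Pol_cst.
by move=> [p /Pol0_cst[c ->] <-]; exists c.
Qed.

Lemma dist_affineE u : L2 u -> dist_affine u = (dist2 u 1)%:E.
Proof.
move=> lu; rewrite -inf_Pol_dist2//; congr ereal_inf; apply/seteqP; split=> y.
  move=> [[c a] _ <-]; exists (fun x => c + dotrV a x); first exact: Pol_affine.
  by congr sqL2; apply/funext => x; rewrite /= opprD addrA.
move=> [p /Pol1_affine[c [a ->]] <-]; exists (c, a) => //.
by congr sqL2; apply/funext => x; rewrite /= opprD addrA.
Qed.

Lemma dist_grad_polyE u m : W12 R n u -> dist_grad_poly m u = (gdist2 u m)%:E.
Proof. by move=> Wu; rewrite -inf_Pol_gdist2// /dist_grad_poly polyfun_Pol. Qed.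

Lemma ae_polyfunP u m : L2 u -> ae_polyfun m u <-> dist2 u m = 0.
Proof. by move=> lu; rewrite dist2_eq0_ae// /ae_polyfun polyfun_Pol. Qed.

Lemma deficitE u : W12 R n u -> deficit u = (gap (dist2 u) (gdist2 u) 0)%:E.
Proof.
move=> Wu; rewrite /deficit sqL2v_grad// dist_constE; last exact: W12_L2.
by rewrite -EFinB /gap mul1r.
Qed.

Definition powX (i : 'I_n) k : 'rV[R]_n -> R := iter k (mulX i) (cst 1).

Lemma Pol_powX (i : 'I_n) k : Pol k (powX i k).
Proof. by elim: k => [|k IH]; [exact: Pol_cst|exact: Pol_mulX]. Qed.

Lemma partial_powX i k : partial i (powX i k.+1) = k.+1%:R \*o powX i k.
Proof.
elim: k => [|k IH].
  rewrite /powX/= partial_mulX; last exact: Pol_diffable (Pol_cst _ 0 1).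
  by rewrite partial_cst eqxx; apply/funext => x; rewrite /mulX/= mulr0 add0r.
rewrite [powX i k.+2]/(mulX i (powX i k.+1)) partial_mulX; last exact: Pol_diffable (Pol_powX i k.+1).
rewrite IH eqxx; apply/funext => x; rewrite /= /powX/= -/(powX i k) /mulX/= -[k.+2%:R]natr1; ring.
Qed.

Lemma iter_partial_powX i k c : iter k (partial i) (c \*o powX i k) = cst (c * k`!%:R).
Proof.
elim: k c => [|k IH] c; first by apply/funext => x; rewrite /powX/= fact0.
rewrite iterSr partialZ; last exact: Pol_diffable (Pol_powX i k.+1).
rewrite partial_powX (_ : _ \*o _ = (c * k.+1%:R) \*o powX i k).
  by rewrite IH factS natrM mulrA.
by apply/funext => x /=; rewrite mulrA.
Qed.

Lemma iter_partial_Pol i m p : Pol m p -> iter m.+1 (partial i) p = cst 0.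
Proof.
elim: m p => [|m IH] p pp; first by have [c ->] := Pol0_cst pp; rewrite /= partial_cst.
by rewrite iterSr IH//; exact: (Pol_partial i pp).
Qed.

Definition hermite i k : 'rV[R]_n -> R := iter k (adjX i) (cst 1).

Lemma Pol_hermite i k : Pol k (hermite i k).
Proof. by elim: k => [|k IH]; [exact: Pol_cst|exact: Pol_adjX]. Qed.

Lemma ip_hermite i k m p : Pol m p ->
  ip p (hermite i k) = ip (iter k (partial i) p) (cst 1).
Proof.
elim: k m p => [|k IH] m p pp //.
by rewrite /hermite iterS -(ip_adjX i pp (Pol_hermite i k)) (IH _ _ (Pol_partial i pp)) -iterSr.
Qed.

(** The Hermite polynomial of degree k + 1 is orthogonal to the polynomials of degree
    at most k, but not to x_i^(k+1): moving the adjoints back as derivatives leaves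
    (k + 1)!. *)
Lemma dist2_powX_gt0 i k : 0 < dist2 (powX i k.+1) k.
Proof.
have pm := Pol_powX i k.+1; have lm := Pol_L2 pm.
rewrite lt_def dist2_ge0 andbT; apply/negP => /eqP d0.
have [pU _] := PprojP k lm; have lU := Pol_L2 pU.
have ph := Pol_hermite i k.+1; have lh := Pol_L2 ph.
have := ip_eq0r lh (L2B lm lU) d0; rewrite ipC ipBl// (ip_hermite _ _ pm) (ip_hermite _ _ pU).
rewrite (iter_partial_Pol i pU).
have -> : iter k.+1 (partial i) (powX i k.+1) = k.+1`!%:R \*o cst 1.
  have -> : powX i k.+1 = 1 \*o powX i k.+1 by apply/funext => x /=; rewrite mul1r.
  by rewrite iter_partial_powX; apply/funext => x /=; rewrite mul1r mulr1.
have l1 : L2 (cst 1 : 'rV[R]_n -> R) by apply: L2_moderate; exact: moderate_cst.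
rewrite [ip (cst 0) _]ipC ip0r subr0 ipZl// => /eqP.
rewrite mulf_eq0 gt_eqF ?ltr0n ?fact_gt0//= gt_eqF//; exact: ip11_gt0.
Qed.

Lemma dist2_powX i k : dist2 (powX i k) k = 0.
Proof.
have lm := Pol_L2 (Pol_powX i k); apply/dist2_eq0_ae => //.
by exists (powX i k); [exact: Pol_powX|exact: aeW].
Qed.

End distances.

Local Open Scope ereal_scope.

Theorem theorem1p4 (R : realType) (n : nat) (n_gt0 : (0 < n)%N) :
  (forall u : 'rV[R]_n -> R, W12 R n u ->
    [/\ dist_affine u <= deficit u,
        deficit u = dist_affine u <-> ae_polyfun 2 u,
        (2^-1)%:E * dist_grad_const u <= deficit u
      & deficit u = (2^-1)%:E * dist_grad_const u <-> ae_polyfun 2 u] /\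
    [/\ dist_poly 2 u <= deficit u - dist_affine u,
        deficit u - dist_affine u = dist_poly 2 u <-> ae_polyfun 3 u,
        (6^-1)%:E * dist_grad_poly 2 u <=
          deficit u - (2^-1)%:E * dist_grad_const u
      & deficit u - (2^-1)%:E * dist_grad_const u =
          (6^-1)%:E * dist_grad_poly 2 u <-> ae_polyfun 3 u] /\
    (deficit u = \sum_(1 <= j <oo) dist_poly j u /\
     \sum_(1 <= j <oo) dist_poly j u =
       \sum_(1 <= j <oo) ((j * j.+1)%:R^-1)%:E * dist_grad_poly j u)) /\
  [/\ forall C : R,
        (forall u, W12 R n u -> C%:E * dist_affine u <= deficit u) ->
        (C <= 1)%R,
      forall C : R,
        (forall u, W12 R n u -> C%:E * dist_grad_const u <= deficit u) ->
        (C <= 2^-1)%R,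
      forall C : R,
        (forall u, W12 R n u ->
          C%:E * dist_poly 2 u <= deficit u - dist_affine u) ->
        (C <= 1)%R
    & forall C : R,
        (forall u, W12 R n u -> C%:E * dist_grad_poly 2 u <=
          deficit u - (2^-1)%:E * dist_grad_const u) ->
        (C <= 6^-1)%R].
Proof.
split=> [u Wu|].
  have lu := W12_L2 Wu; have Dn m := dist2_noninc m lu.
  have ae m : ae_polyfun m u = (dist2 u m = 0%R) by exact: propext (ae_polyfunP m lu).
  rewrite (deficitE Wu) (dist_affineE lu) (dist_grad_constE Wu) (dist_polyE 2 lu).
  rewrite (dist_grad_polyE 2 Wu) (ae 2%N) (ae 3%N).
  split; first exact: (sharp_stability (dist2_ge0 u) Dn (dist2_cvg lu)
    (gdist2_cvg Wu) (fun m => gdist2_succ m Wu)).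
  split; first exact: (sharp_stability_of_stability (dist2_ge0 u) Dn
    (dist2_cvg lu) (gdist2_cvg Wu) (fun m => gdist2_succ m Wu)).
  have -> : \sum_(1 <= j <oo) dist_poly j u = (gap (dist2 u) (gdist2 u) 0)%:E.
    rewrite -(sum_D (dist2_ge0 u) Dn (dist2_cvg lu) (gdist2_cvg Wu)
      (fun m => gdist2_succ m Wu)).
    by apply: eq_eseriesr => j _; rewrite dist_polyE.
  split => //.
  rewrite -(sum_E (dist2_cvg lu) (gdist2_cvg Wu)
      (fun m => gdist2_succ m Wu)).
  by apply: eq_eseriesr => j _; rewrite dist_grad_polyE.
pose i0 : 'I_n := Ordinal n_gt0.
have W k : W12 R n (@powX R n i0 k) by exact: W12_Pol (Pol_powX R i0 k).
have sharp k := sharp_constants (dist2_ge0 (@powX R n i0 k))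
  (fun m => dist2_noninc m (W12_L2 (W k))) (dist2_cvg (W12_L2 (W k))) (gdist2_cvg (W k))
  (fun m => gdist2_succ m (W k)).
have pos k := dist2_powX_gt0 R i0 k; have zero k := dist2_powX R i0 k.
split=> C.
- move=> /(_ _ (W 2%N)); rewrite (deficitE (W _)) (dist_affineE (W12_L2 (W _))).
  exact: (sharp 2%N C).1 (pos 1%N) (zero 2%N).
- move=> /(_ _ (W 2%N)); rewrite (deficitE (W _)) (dist_grad_constE (W _)).
  exact: (sharp 2%N C).2.1 (pos 1%N) (zero 2%N).
- move=> /(_ _ (W 3%N)); rewrite (deficitE (W _)) (dist_affineE (W12_L2 (W _))).
  rewrite (dist_polyE 2 (W12_L2 (W _))).
  exact: (sharp 3%N C).2.2.1 (pos 2%N) (zero 3%N).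
- move=> /(_ _ (W 3%N)); rewrite (deficitE (W _)) (dist_grad_constE (W _)).
  rewrite (dist_grad_polyE 2 (W _)).
  exact: (sharp 3%N C).2.2.2 (pos 2%N) (zero 3%N).
Qed.
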